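(* Let $0<k'<1$, $k=\sqrt{1-k'^2}$, let $K$ and $K'$ be the complete elliptic integrals of the first kind of moduli $k$ and $k'$ respectively, and put $v=\exp(-\pi K/K')$. Define for $n=0,1,2,\dots$ $$b_n=\begin{cases}(k'+3)n/2+1,& n\equiv 0\pmod 4,\\ (3k'+1)n/2+(k'+1)/2,& n\equiv 1\pmod 4,\\ (3k'+1)n/2+k',& n\equiv 2\pmod 4,\\ (k'+3)n/2+(k'+1)/2,& n\equiv 3\pmod 4,\end{cases}\qquad u_n=\begin{cases}k'(k'+1)n^2,& n\equiv 0\pmod 4,\\ 2k'n^2,& n\equiv 1,3\pmod 4,\\ (1+k')n^2,& n\equiv 2\pmod 4,\end{cases}$$ and let $P_n(x)$ be the monic polynomials with $P_0=1$, $P_1(x)=x-b_0$, $P_{n+1}(x)+b_nP_n(x)+u_nP_{n-1}(x)=xP_n(x)$. Let $$x_s=\frac{\pi(s-1/2)}{K'},\qquad M_s=\frac{\pi}{k'K'}\,\frac{v^{-(s-1/2)/2}}{v^{s-1/2}+v^{1/2-s}},\qquad s\in\mathbb{Z}.$$ Then $\sum_{s=-\infty}^{\infty}M_sP_n(x_s)P_m(x_s)=h_n\delta_{nm}$ for all $n,m\ge0$, where $h_n=c_0u_1u_2\cdots u_n$ with $c_0=\sqrt{\frac{1+k'}{k'}}$. *)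

(* Defs.v *)
From Stdlib Require Import Reals ZArith.
From Coquelicot Require Import Coquelicot.
Open Scope R_scope.

Definition ellK (k : R) : R :=
  RInt (fun t => / sqrt (1 - k ^ 2 * (sin t) ^ 2)) 0 (PI / 2).

Definition b (kp : R) (n : nat) : R :=
  let x := INR n in
  match (n mod 4)%nat with
  | 0%nat => (kp + 3) * x / 2 + 1
  | 1%nat => (3 * kp + 1) * x / 2 + (kp + 1) / 2
  | 2%nat => (3 * kp + 1) * x / 2 + kp
  | _ => (kp + 3) * x / 2 + (kp + 1) / 2
  end.

Definition u (kp : R) (n : nat) : R :=
  let x := INR n in
  match (n mod 4)%nat with
  | 0%nat => kp * (kp + 1) * x ^ 2
  | 2%nat => (1 + kp) * x ^ 2
  | _ => 2 * kp * x ^ 2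
  end.

Fixpoint Ppair (kp x : R) (n : nat) : R * R :=
  match n with
  | O => (1, x - b kp 0)
  | S m => let (p, q) := Ppair kp x m in
           (q, (x - b kp (S m)) * q - u kp (S m) * p)
  end.

Definition P (kp : R) (n : nat) (x : R) : R := fst (Ppair kp x n).

Definition c0 (kp : R) : R := sqrt ((1 + kp) / kp).

Fixpoint h (kp : R) (n : nat) : R :=
  match n with
  | O => c0 kp
  | S m => h kp m * u kp (S m)
  end.

Definition vv (kp : R) : R := exp (- PI * ellK (sqrt (1 - kp ^ 2)) / ellK kp).

Definition xs (kp : R) (s : Z) : R := PI * (IZR s - / 2) / ellK kp.

Definition Ms (kp : R) (s : Z) : R :=
  let a := IZR s - / 2 in
  PI / (kp * ellK kp) *
  (Rpower (vv kp) (- a / 2) / (Rpower (vv kp) a + Rpower (vv kp) (- a))).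

Definition term (kp : R) (n m : nat) (s : Z) : R :=
  Ms kp s * P kp n (xs kp s) * P kp m (xs kp s).

(* Main.v *)
Require Import Defs.
From Stdlib Require Import Reals ZArith Arith.
From Coquelicot Require Import Coquelicot.
From Stdlib Require Import Lra Lia.
Open Scope R_scope.

(** With [a = s - 1/2] and [v = exp (-y)], the moment generating function of the weights [M_s] is
    a multiple of [F (t + y/2)], where [F t = sum_a exp (a t) / cosh (a y)]; together with
    [G t = sum_n exp (n t) / cosh (n y)] and [H t = sum_a exp (a t) / sinh (a y)] it satisfies
    [F' = G H / 2], [G' = F H / 2], [H' = F G / 2]: the coefficient convolutions telescope by
    [sinh (A + B) / (cosh A cosh B) = tanh A + tanh B] and its analogues.  So [F], [G], [H] are
    multiples of nc, dc, sc for the complementary modulus [F 0 / G 0]; the imaginary period ([PI],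
    from the cosine series) and the real blow-up time ([y]) express both complete integrals through
    [G 0], and monotonicity of their ratio gives [F 0 / G 0 = k'].  Finally [P_n (d/dt)] applied to
    nc is an explicit polynomial in nc and nc' which, for [n >= 1], vanishes at the quarter period
    [y/2], so [sum_s M_s P_n (x_s) = 0]; the three-term recurrence then gives full orthogonality. *)

(** * Bilateral sums *)

(** Elliptic functions enter only through the differential system. The exponential series live on
    [|t| < y]; the cosine and sine series with the same coefficients exist for every real [t],
    satisfy the system up to signs, and stand in for imaginary arguments. Neither family knows its
    modulus beforehand: [F 0 / G 0] is a number attached to [y], and matching it with [k'] is a
    separate problem. The factor [v^(-(s-1/2)/2)] of [M_s] is [exp (a y / 2)], so summing against
    [M_s] means evaluating at [t = y/2]. That point is distinguished because [nc] there equals its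
    own derivative in the normalised argument and [nc^2 = (1+k')/k'], which is the origin of [c_0].
    Differentiation in [t] multiplies the weights by a multiple of [x_s] and so turns [P_n] into a
    differential operator. A closed form exists because, on each class mod 4, [b_n] is affine in [n]
    and [u_n] is a constant times [n^2]: one polynomial factor is gained every four steps, and all
    verifications become finitely many identities. *)

(* [Z] is enumerated by pairing [j] with [-j-1]. *)
Definition zs (f : Z -> R) (j : nat) : R := f (Z.of_nat j) + f (- Z.of_nat j - 1)%Z.
Definition zsum (f : Z -> R) : R := Series (zs f).
Definition is_zsum (f : Z -> R) (l : R) : Prop := is_series (zs f) l.
(** The paired series of [f] could converge by cancellation inside the pairs; with absolute values
    convergence no longer depends on the enumeration, and shifts, reflections and products are
    legitimate. *)
Definition zabs (f : Z -> R) : Prop := ex_series (zs (fun s => Rabs (f s))).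

Lemma ex_series_le_R (a b : nat -> R) :
  (forall n, Rabs (a n) <= b n) -> ex_series b -> ex_series a.
Proof. intros H Hb. apply (ex_series_le a b); [exact H|exact Hb]. Qed.

Lemma zabs_le (f g : Z -> R) : (forall s, Rabs (f s) <= g s) -> ex_series (zs g) -> zabs f.
Proof.
  intros H Hg. apply ex_series_le_R with (zs g); [|exact Hg].
  intros n; unfold zs.
  rewrite Rabs_pos_eq.
  - apply Rplus_le_compat; apply H.
  - apply Rplus_le_le_0_compat; apply Rabs_pos.
Qed.

Lemma zabs_dom (f g : Z -> R) : (forall s, Rabs (f s) <= Rabs (g s)) -> zabs g -> zabs f.
Proof. intros H Hg. apply zabs_le with (fun s => Rabs (g s)); assumption. Qed.

Lemma zabs_ext (f g : Z -> R) : (forall s, f s = g s) -> zabs f -> zabs g.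
Proof. intros H. apply zabs_dom; intros s; rewrite H; apply Rle_refl. Qed.

Lemma zsum_ext (f g : Z -> R) : (forall s, f s = g s) -> zsum f = zsum g.
Proof. intros H. apply Series_ext; intros n; unfold zs; now rewrite !H. Qed.

Lemma is_zsum_ext (f g : Z -> R) l : (forall s, f s = g s) -> is_zsum f l -> is_zsum g l.
Proof. intros H. apply is_series_ext; intros n; unfold zs; now rewrite !H. Qed.

Lemma is_zsum_unique (f : Z -> R) l : is_zsum f l -> zsum f = l.
Proof. apply is_series_unique. Qed.

Lemma zabs_sides (f : Z -> R) : zabs f ->
  ex_series (fun j => f (Z.of_nat j)) /\ ex_series (fun j => f (- Z.of_nat j - 1)%Z).
Proof.
  intros H; split; (apply ex_series_le_R with (2 := H)); intros n; unfold zs;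
    pose proof (Rabs_pos (f (Z.of_nat n))); pose proof (Rabs_pos (f (- Z.of_nat n - 1)%Z)); lra.
Qed.

Lemma zabs_Rabs (f : Z -> R) : zabs f -> zabs (fun s => Rabs (f s)).
Proof. apply zabs_dom; intros s; rewrite Rabs_Rabsolu; apply Rle_refl. Qed.

Lemma zabs_of_sides (f : Z -> R) :
  ex_series (fun j => Rabs (f (Z.of_nat j))) ->
  ex_series (fun j => Rabs (f (- Z.of_nat j - 1)%Z)) -> zabs f.
Proof. intros H1 H2. exact (ex_series_plus _ _ H1 H2). Qed.

Lemma zabs_correct (f : Z -> R) : zabs f -> is_zsum f (zsum f).
Proof.
  intros H; apply Series_correct.
  destruct (zabs_sides f H) as [H1 H2]. exact (ex_series_plus _ _ H1 H2).
Qed.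

Lemma is_zsum_plus (f g : Z -> R) l1 l2 :
  is_zsum f l1 -> is_zsum g l2 -> is_zsum (fun s => f s + g s) (l1 + l2).
Proof.
  intros H1 H2. eapply is_series_ext; [|exact (is_series_plus _ _ _ _ H1 H2)].
  intros n; unfold zs, plus; simpl; ring.
Qed.

Lemma is_zsum_scal c (f : Z -> R) l : is_zsum f l -> is_zsum (fun s => c * f s) (c * l).
Proof.
  intros H1. eapply is_series_ext; [|exact (is_series_scal c _ _ H1)].
  intros n; unfold zs, scal; simpl; unfold mult; simpl; ring.
Qed.

Lemma is_zsum_minus (f g : Z -> R) l1 l2 :
  is_zsum f l1 -> is_zsum g l2 -> is_zsum (fun s => f s - g s) (l1 - l2).
Proof.
  intros H1 H2. replace (l1 - l2) with (l1 + (-1) * l2) by ring.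
  eapply is_zsum_ext; [|exact (is_zsum_plus _ _ _ _ H1 (is_zsum_scal (-1) _ _ H2))].
  intros s; simpl; ring.
Qed.

Lemma zabs_plus (f g : Z -> R) : zabs f -> zabs g -> zabs (fun s => f s + g s).
Proof.
  intros H1 H2. apply zabs_le with (fun s => Rabs (f s) + Rabs (g s)).
  - intros s; apply Rabs_triang.
  - exists (zsum (fun s => Rabs (f s)) + zsum (fun s => Rabs (g s))).
    apply is_zsum_plus; apply zabs_correct; now apply zabs_Rabs.
Qed.

Lemma zabs_scal c (f : Z -> R) : zabs f -> zabs (fun s => c * f s).
Proof.
  intros H1. apply zabs_le with (fun s => Rabs c * Rabs (f s)).
  - intros s; rewrite Rabs_mult; apply Rle_refl.
  - exists (Rabs c * zsum (fun s => Rabs (f s))).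
    apply is_zsum_scal; apply zabs_correct; now apply zabs_Rabs.
Qed.

Lemma zabs_minus (f g : Z -> R) : zabs f -> zabs g -> zabs (fun s => f s - g s).
Proof.
  intros H1 H2. apply zabs_ext with (fun s => f s + (-1) * g s); [intros; ring|].
  apply zabs_plus; [|apply zabs_scal]; assumption.
Qed.

Lemma zsum_plus (f g : Z -> R) : zabs f -> zabs g ->
  zsum (fun s => f s + g s) = zsum f + zsum g.
Proof. intros H1 H2. apply is_zsum_unique, is_zsum_plus; now apply zabs_correct. Qed.

Lemma zsum_minus (f g : Z -> R) : zabs f -> zabs g ->
  zsum (fun s => f s - g s) = zsum f - zsum g.
Proof. intros H1 H2. apply is_zsum_unique, is_zsum_minus; now apply zabs_correct. Qed.

Lemma zsum_scal c (f : Z -> R) : zsum (fun s => c * f s) = c * zsum f.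
Proof.
  unfold zsum. rewrite <- Series_scal_l. apply Series_ext; intros n; unfold zs; ring.
Qed.

Lemma Series_le_R (a b : nat -> R) :
  (forall n, a n <= b n) -> ex_series a -> ex_series b -> Series a <= Series b.
Proof.
  intros H Ha Hb.
  assert (K : is_series (fun n => b n - a n) (Series b - Series a)).
  { eapply is_series_ext; [|exact (is_series_minus _ _ _ _ (Series_correct _ Hb) (Series_correct _ Ha))].
    intros n; reflexivity. }
  rewrite <- (Rminus_0_r (Series b)), <- (Rminus_0_r (Series a)).
  assert (0 <= Series b - Series a); [|lra].
  rewrite <- (is_series_unique _ _ K).
  (* Zero is written as the sum of [0 * (b n - a n)], so that the comparison is between non-negative
     sequences. *)
  rewrite <- (Rmult_0_l (Series (fun n => b n - a n))), <- Series_scal_l.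
  apply Series_le; [|eexists; exact K].
  intros n; specialize (H n); lra.
Qed.

Lemma zsum_le (f g : Z -> R) : zabs f -> zabs g -> (forall s, f s <= g s) -> zsum f <= zsum g.
Proof.
  intros Hf Hg H. apply Series_le_R.
  - intros n; unfold zs; apply Rplus_le_compat; apply H.
  - eexists; apply zabs_correct, Hf.
  - eexists; apply zabs_correct, Hg.
Qed.

Lemma zsum_Rabs (f : Z -> R) : zabs f -> Rabs (zsum f) <= zsum (fun s => Rabs (f s)).
Proof.
  intros H. apply Rabs_le. split.
  - replace (- zsum (fun s => Rabs (f s))) with ((-1) * zsum (fun s => Rabs (f s))) by ring.
    rewrite <- zsum_scal. apply zsum_le; auto using zabs_Rabs, zabs_scal.
    intros s; pose proof (Rle_abs (- f s)); rewrite Rabs_Ropp in *; lra.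
  - apply zsum_le; auto using zabs_Rabs. intros s; apply Rle_abs.
Qed.

(** The map [s -> -s-1] exchanges the two members of every pair, so the paired series is preserved
    term by term. *)
Lemma zsum_refl1 (f : Z -> R) : zsum (fun s => f (- s - 1)%Z) = zsum f.
Proof.
  apply Series_ext; intros n; unfold zs.
  rewrite Rplus_comm. f_equal; f_equal; lia.
Qed.

Lemma zabs_refl1 (f : Z -> R) : zabs f -> zabs (fun s => f (- s - 1)%Z).
Proof.
  apply ex_series_ext; intros n; unfold zs.
  rewrite Rplus_comm. f_equal; f_equal; f_equal; lia.
Qed.

Lemma zabs_succ (f : Z -> R) : zabs f -> zabs (fun s => f (s + 1)%Z).
Proof.
  intros H. destruct (zabs_sides _ (zabs_Rabs _ H)) as [H1 H2]. apply zabs_of_sides.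
  - apply ex_series_ext with (fun k => Rabs (f (Z.of_nat (S k)))).
    { intros n; do 2 f_equal; lia. }
    apply (ex_series_incr_1 (fun k => Rabs (f (Z.of_nat k)))), H1.
  - apply (ex_series_incr_1 (fun j => Rabs (f (- Z.of_nat j - 1 + 1)%Z))).
    apply ex_series_ext with (2 := H2). intros n; do 2 f_equal; lia.
Qed.

Lemma zsum_succ (f : Z -> R) : zabs f -> zsum (fun s => f (s + 1)%Z) = zsum f.
Proof.
  intros H. destruct (zabs_sides _ H) as [H1 H2].
  destruct (zabs_sides _ (zabs_succ _ H)) as [H3 H4].
  unfold zsum, zs.
  rewrite (Series_plus _ _ H1 H2), (Series_plus _ _ H3 H4).
  rewrite (Series_incr_1 _ H1), (Series_incr_1 _ H4).
  rewrite (Series_ext (fun k => f (Z.of_nat (S k))) (fun j => f (Z.of_nat j + 1)%Z)).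
  2:{ intros n; f_equal; lia. }
  rewrite (Series_ext (fun k => f (- Z.of_nat (S k) - 1 + 1)%Z) (fun j => f (- Z.of_nat j - 1)%Z)).
  2:{ intros n; f_equal; lia. }
  replace (- Z.of_nat 0 - 1 + 1)%Z with (Z.of_nat 0) by lia. ring.
Qed.

(** Forward shifts iterate [zsum_succ]; a backward shift is a forward one conjugated by
    [s -> -s-1]. *)
Lemma zsum_shift (f : Z -> R) (k : Z) : zabs f ->
  zabs (fun s => f (s + k)%Z) /\ zsum (fun s => f (s + k)%Z) = zsum f.
Proof.
  intros H.
  assert (N : forall g, zabs g -> forall n : nat, zabs (fun s => g (s + Z.of_nat n)%Z) /\
              zsum (fun s => g (s + Z.of_nat n)%Z) = zsum g).
  { intros g Hg n. induction n as [|n [I1 I2]].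
    - split.
      + apply zabs_ext with (2 := Hg). intros s; f_equal; lia.
      + apply zsum_ext. intros s; f_equal; lia.
    - pose proof (zabs_succ _ I1) as J1. pose proof (zsum_succ _ I1) as J2. simpl in J1, J2.
      split.
      + apply zabs_ext with (2 := J1). intros s; f_equal; lia.
      + rewrite <- I2, <- J2. apply zsum_ext. intros s; f_equal; lia. }
  destruct (Z_le_gt_dec 0 k) as [Hk|Hk].
  - destruct (N f H (Z.to_nat k)) as [A B]. rewrite Z2Nat.id in A, B by lia. now split.
  - destruct (N _ (zabs_refl1 _ H) (Z.to_nat (- k))) as [A B].
    rewrite Z2Nat.id in A, B by lia.
    apply zabs_refl1 in A. rewrite zsum_refl1 in B. rewrite <- B.
    split.
    + apply zabs_ext with (2 := A). intros s; f_equal; lia.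
    + rewrite <- zsum_refl1. apply zsum_ext. intros s; f_equal; lia.
Qed.

Lemma zsum_pred (f : Z -> R) : zabs f -> zsum (fun s => f (s - 1)%Z) = zsum f.
Proof. intros H. exact (proj2 (zsum_shift f (-1) H)). Qed.

Lemma zsum_reflect (f : Z -> R) (k : Z) : zabs f ->
  zabs (fun s => f (k - s)%Z) /\ zsum (fun s => f (k - s)%Z) = zsum f.
Proof.
  intros H. destruct (zsum_shift f (k + 1) H) as [A B].
  apply zabs_refl1 in A. rewrite <- zsum_refl1 in B. split.
  - apply zabs_ext with (2 := A). intros s; f_equal; lia.
  - rewrite <- B. apply zsum_ext. intros s; f_equal; lia.
Qed.

(** * Partial-sum bounds, Fubini, Cauchy products and termwise differentiation *)

Lemma series_partial_le (a : nat -> R) (l : R) (n : nat) :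
  (forall k, 0 <= a k) -> is_series a l -> sum_n a n <= l.
Proof.
  intros Ha Hl. apply is_lim_seq_incr_compare with (1 := Hl).
  intros k. rewrite sum_Sn. unfold plus; simpl. specialize (Ha (S k)); lra.
Qed.

Lemma zsum_le_term (f : Z -> R) : zabs f -> forall s, Rabs (f s) <= zsum (fun s => Rabs (f s)).
Proof.
  intros H s.
  destruct (zsum_shift (fun s => Rabs (f s)) s (zabs_Rabs _ H)) as [A <-].
  pose proof (zabs_correct _ A) as B. apply series_partial_le with (n := 0%nat) in B.
  - rewrite sum_O in B. unfold zs in B.
    pose proof (Rabs_pos (f (- Z.of_nat 0 - 1 + s)%Z)).
    replace (Z.of_nat 0 + s)%Z with s in B by lia. lra.
  - intros k; apply Rplus_le_le_0_compat; apply Rabs_pos.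
Qed.

(** Tonelli as an inequality: finite blocks of the array are bounded by the sum of the row totals,
    so the columns converge and their total is at most [L]. *)
Lemma fubini_pos_half (g : nat -> nat -> R) (A : nat -> R) (L : R) :
  (forall i j, 0 <= g i j) -> (forall i, is_series (g i) (A i)) -> is_series A L ->
  (forall j, ex_series (fun i => g i j)) /\
  exists L', L' <= L /\ is_series (fun j => Series (fun i => g i j)) L'.
Proof.
  intros Hg HA HL.
  assert (HA0 : forall i j, sum_n (g i) j <= A i) by (intros; apply series_partial_le; auto).
  assert (A0 : forall i, 0 <= A i).
  { intros i. eapply Rle_trans; [|apply (HA0 i 0%nat)]. rewrite sum_O. apply Hg. }
  assert (Hpos : forall (a : nat -> R) n, (forall k, 0 <= a k) -> 0 <= sum_n a n).
  { intros a n Ha. induction n; [rewrite sum_O; apply Ha|].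
    rewrite sum_Sn; unfold plus; simpl. specialize (Ha (S n)); lra. }
  assert (Hbd : forall (a : nat -> R) M, (forall k, 0 <= a k) -> (forall n, sum_n a n <= M) ->
            exists l, l <= M /\ is_series a l).
  { intros a M Ha HM.
    destruct (ex_finite_lim_seq_incr (sum_n a) M) as [l Hl]; auto.
    - intros n. rewrite sum_Sn; unfold plus; simpl. specialize (Ha (S n)); lra.
    - exists l; split; [|exact Hl].
      apply (is_lim_seq_le (sum_n a) (fun _ => M) l M HM Hl (is_lim_seq_const M)). }
  assert (Hcol : forall j, ex_series (fun i => g i j)).
  { intros j. destruct (Hbd (fun i => g i j) L) as [l [_ Hl]].
    - intros; apply Hg.
    - intros n. eapply Rle_trans; [|apply (series_partial_le A L n A0 HL)].
      apply sum_n_m_le. intros k. eapply Rle_trans; [|apply (HA0 k j)].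
      destruct j; [rewrite sum_O; apply Rle_refl|].
      rewrite sum_Sn; unfold plus; simpl. pose proof (Hpos (g k) j (Hg k)). lra.
    - now exists l. }
  split; [exact Hcol|].
  destruct (Hbd (fun j => Series (fun i => g i j)) L) as [l [H1 H2]].
  - intros j. eapply Rle_trans; [|apply (series_partial_le _ _ 0 (fun i => Hg i j) (Series_correct _ (Hcol j)))].
    rewrite sum_O; apply Hg.
  - intros m.
    assert (Hm : is_series (fun i => sum_n (g i) m) (sum_n (fun j => Series (fun i => g i j)) m)).
    { induction m.
      - rewrite sum_O. eapply is_series_ext; [|apply Series_correct, (Hcol 0%nat)].
        intros n; simpl; now rewrite sum_O.
      - rewrite sum_Sn. eapply is_series_ext; [|exact (is_series_plus _ _ _ _ IHm (Series_correct _ (Hcol (S m))))].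
        intros n; simpl; now rewrite sum_Sn. }
    rewrite <- (is_series_unique _ _ Hm), <- (is_series_unique _ _ HL).
    apply Series_le_R; [|eexists; exact Hm|eexists; exact HL]. intros n; apply HA0.
  - exists l; now split.
Qed.

(** The inequality is applied to [g] and then to its transpose, so each order of summation bounds
    the other. *)
Lemma fubini_pos (g : nat -> nat -> R) (A : nat -> R) (L : R) :
  (forall i j, 0 <= g i j) -> (forall i, is_series (g i) (A i)) -> is_series A L ->
  (forall j, ex_series (fun i => g i j)) /\ is_series (fun j => Series (fun i => g i j)) L.
Proof.
  intros Hg HA HL.
  destruct (fubini_pos_half g A L Hg HA HL) as [H1 [L' [H2 H3]]]. split; [exact H1|].
  destruct (fubini_pos_half (fun j i => g i j) _ L' (fun j i => Hg i j)
             (fun j => Series_correct _ (H1 j)) H3) as [_ [L2 [H4 H5]]].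
  assert (L2 = L).
  { rewrite <- (is_series_unique _ _ H5), <- (is_series_unique _ _ HL).
    apply Series_ext; intros n. now apply is_series_unique. }
  replace L with L' by lra. exact H3.
Qed.

(** Since [g = (g + b) - b] with both arrays non-negative, the signed case is the difference of two
    positive ones. *)
Lemma fubini_nat (g b : nat -> nat -> R) (A : nat -> R) :
  (forall i j, Rabs (g i j) <= b i j) -> (forall i, is_series (b i) (A i)) -> ex_series A ->
  is_series (fun j => Series (fun i => g i j)) (Series (fun i => Series (g i))).
Proof.
  intros Hg HA [L HL].
  assert (Hgi : forall i, ex_series (g i)).
  { intros i; apply ex_series_le_R with (b i); [apply Hg|now exists (A i)]. }
  assert (Hgi' : forall i, Rabs (Series (g i)) <= A i).
  { intros i. rewrite <- (is_series_unique _ _ (HA i)).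
    eapply Rle_trans; [apply Series_Rabs|].
    - apply ex_series_le_R with (b i); [intros; rewrite Rabs_Rabsolu; apply Hg|now exists (A i)].
    - apply Series_le; [intros; split; [apply Rabs_pos|apply Hg]|now exists (A i)]. }
  assert (Hs : is_series (fun i => Series (g i)) (Series (fun i => Series (g i)))).
  { apply Series_correct. apply ex_series_le_R with A; [exact Hgi'|now exists L]. }
  destruct (fubini_pos b A L) as [B1 B2]; auto.
  { intros i j; eapply Rle_trans; [apply Rabs_pos|apply Hg]. }
  destruct (fubini_pos (fun i j => g i j + b i j) (fun i => Series (g i) + A i)
             (Series (fun i => Series (g i)) + L)) as [C1 C2].
  - intros i j. specialize (Hg i j). pose proof (Rle_abs (- g i j)). rewrite Rabs_Ropp in *. lra.
  - intros i. exact (is_series_plus _ _ _ _ (Series_correct _ (Hgi i)) (HA i)).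
  - exact (is_series_plus _ _ _ _ Hs HL).
  - replace (Series (fun i => Series (g i))) with (Series (fun i => Series (g i)) + L - L) by ring.
    eapply is_series_ext; [|exact (is_series_minus _ _ _ _ C2 B2)].
    intros j. unfold minus, plus, opp; simpl.
    rewrite (Series_plus (fun i => g i j) (fun i => b i j)); [ring| |auto].
    apply ex_series_le_R with (fun i => b i j); auto.
Qed.

(** Pairing in both variables reduces this to arrays over [nat]: each entry [G i j] collects four
    values of [g]. *)
Lemma zfubini (g : Z -> Z -> R) :
  (forall s, zabs (g s)) -> zabs (fun s => zsum (fun n => Rabs (g s n))) ->
  is_zsum (fun n => zsum (fun s => g s n)) (zsum (fun s => zsum (g s))).
Proof.
  intros H1 H2.
  pose (G := fun i j => zs (fun s => zs (g s) j) i).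
  pose (B := fun i j => zs (fun s => zs (fun n => Rabs (g s n)) j) i).
  pose (A := zs (fun s => zsum (fun n => Rabs (g s n)))).
  assert (HB : forall i, is_series (B i) (A i)).
  { intros i. exact (is_series_plus _ _ _ _ (zabs_correct _ (zabs_Rabs _ (H1 (Z.of_nat i))))
      (zabs_correct _ (zabs_Rabs _ (H1 (- Z.of_nat i - 1)%Z)))). }
  assert (HA : ex_series A) by (eexists; apply zabs_correct, H2).
  assert (HGB : forall i j, Rabs (G i j) <= B i j).
  { intros i j. unfold G, B, zs.
    repeat (eapply Rle_trans; [apply Rabs_triang|]; apply Rplus_le_compat); apply Rle_refl. }
  pose proof (fubini_nat G B A HGB HB HA) as F.
  assert (E : Series (fun i => Series (G i)) = zsum (fun s => zsum (g s))).
  { apply Series_ext; intros i. apply is_series_unique.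
    exact (is_series_plus _ _ _ _ (zabs_correct _ (H1 (Z.of_nat i)))
      (zabs_correct _ (H1 (- Z.of_nat i - 1)%Z))). }
  rewrite <- E. unfold is_zsum. eapply is_series_ext; [|exact F].
  assert (Hc : forall n, zabs (fun s => g s n)).
  { intros n. apply zabs_dom with (2 := H2). intros s.
    rewrite (Rabs_pos_eq (zsum _)).
    - now apply zsum_le_term.
    - eapply Rle_trans; [apply Rabs_pos|apply (zsum_le_term _ (H1 s) n)]. }
  intros j. apply is_series_unique.
  pose proof (is_zsum_plus _ _ _ _ (zabs_correct _ (Hc (Z.of_nat j))) (zabs_correct _ (Hc (- Z.of_nat j - 1)%Z))) as K.
  exact K.
Qed.

Lemma zabs_conv (f h : Z -> R) N : zabs f -> zabs h -> zabs (fun s => f s * h (N - s)%Z).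
Proof.
  intros Hf Hh. apply zabs_dom with (fun s => zsum (fun n => Rabs (h n)) * f s).
  - intros s. rewrite !Rabs_mult, Rmult_comm. apply Rmult_le_compat_r; [apply Rabs_pos|].
    eapply Rle_trans; [apply (zsum_le_term _ Hh)|apply Rle_abs].
  - now apply zabs_scal.
Qed.

(** Cauchy product: for fixed [s] the substitution [n = N - s] is a shift, which leaves the inner
    sum unchanged, and Fubini exchanges [s] and [N]. *)
Lemma zsum_conv (f h : Z -> R) : zabs f -> zabs h ->
  is_zsum (fun N => zsum (fun s => f s * h (N - s)%Z)) (zsum f * zsum h).
Proof.
  intros Hf Hh.
  assert (K : forall s, zabs (fun N => h (N - s)%Z) /\ zsum (fun N => h (N - s)%Z) = zsum h).
  { intros s. apply (zsum_shift h (- s) Hh). }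
  assert (K' : forall s, zsum (fun N => Rabs (h (N - s)%Z)) = zsum (fun N => Rabs (h N))).
  { intros s. apply (zsum_shift (fun n => Rabs (h n)) (- s) (zabs_Rabs _ Hh)). }
  replace (zsum f * zsum h) with (zsum (fun s => zsum (fun N => f s * h (N - s)%Z))).
  - apply (zfubini (fun s N => f s * h (N - s)%Z)).
    + intros s. apply zabs_scal, K.
    + apply zabs_ext with (fun s => zsum (fun n => Rabs (h n)) * Rabs (f s)).
      * intros s. rewrite <- (K' s), Rmult_comm, <- zsum_scal. apply zsum_ext.
        intros n. now rewrite Rabs_mult.
      * now apply zabs_scal, zabs_Rabs.
  - rewrite Rmult_comm, <- zsum_scal. apply zsum_ext; intros s.
    rewrite zsum_scal. destruct (K s) as [_ ->]. ring.
Qed.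

Lemma zsum_derive (f : Z -> R -> R) (df B : Z -> R) (x d : R) : 0 < d ->
  (forall h, Rabs h < d -> zabs (fun s => f s (x + h))) -> zabs df -> zabs B ->
  (forall h s, Rabs h < d -> Rabs (f s (x + h) - f s x - h * df s) <= h ^ 2 * B s) ->
  is_derive (fun t => zsum (fun s => f s t)) x (zsum df).
Proof.
  intros Hd Hf Hdf HB H.
  assert (Hf0 : zabs (fun s => f s x)).
  { apply zabs_ext with (fun s => f s (x + 0)); [intros; now rewrite Rplus_0_r|].
    apply Hf. now rewrite Rabs_R0. }
  (* The [+ 1] keeps [M] positive, as needed for the radius [eps / M]. *)
  pose (M := zsum (fun s => Rabs (B s)) + 1).
  assert (HM : 0 < M).
  { pose proof (Rabs_pos (B 0%Z)). pose proof (zsum_le_term _ HB 0%Z). unfold M; lra. }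
  assert (Q : forall h, Rabs h < d ->
     Rabs (zsum (fun s => f s (x + h)) - zsum (fun s => f s x) - h * zsum df) <= h ^ 2 * M).
  { intros h Hh.
    rewrite <- zsum_scal, <- zsum_minus by auto.
    rewrite <- zsum_minus; auto using zabs_minus, zabs_scal.
    eapply Rle_trans; [apply zsum_Rabs; auto using zabs_minus, zabs_scal|].
    apply Rle_trans with (h ^ 2 * zsum (fun s => Rabs (B s))).
    - rewrite <- zsum_scal. apply zsum_le.
      + apply zabs_Rabs; auto using zabs_minus, zabs_scal.
      + auto using zabs_scal, zabs_Rabs.
      + intros s. eapply Rle_trans; [now apply H|].
        apply Rmult_le_compat_l; [apply pow2_ge_0|apply Rle_abs].
    - apply Rmult_le_compat_l; [apply pow2_ge_0|unfold M; lra]. }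
  apply is_derive_Reals. intros eps Heps.
  assert (Hdel : 0 < Rmin d (eps / M)).
  { apply Rmin_glb_lt; [lra|]. now apply Rdiv_lt_0_compat. }
  exists (mkposreal _ Hdel). simpl. intros h Hh0 Hh.
  assert (Hh1 : Rabs h < d) by (eapply Rlt_le_trans; [exact Hh|apply Rmin_l]).
  assert (Hh2 : Rabs h < eps / M) by (eapply Rlt_le_trans; [exact Hh|apply Rmin_r]).
  specialize (Q h Hh1).
  set (X := zsum (fun s => f s (x + h))) in *. set (Y := zsum (fun s => f s x)) in *.
  assert (Hp : 0 < Rabs h) by now apply Rabs_pos_lt.
  replace ((X - Y) / h - zsum df) with ((X - Y - h * zsum df) / h) by (field; auto).
  unfold Rdiv. rewrite Rabs_mult, Rabs_inv.
  apply Rmult_lt_reg_r with (Rabs h); [exact Hp|].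
  rewrite Rmult_assoc, Rinv_l, Rmult_1_r by lra.
  eapply Rle_lt_trans; [exact Q|].
  rewrite <- (pow2_abs h). simpl. rewrite Rmult_1_r.
  rewrite Rmult_assoc, (Rmult_comm eps). apply Rmult_lt_compat_l; [exact Hp|].
  apply Rmult_lt_reg_r with (/ M); [now apply Rinv_0_lt_compat|].
  rewrite Rmult_assoc, Rinv_r, Rmult_1_r by lra. exact Hh2.
Qed.

(** * Exponential and trigonometric sums *)

Definition esum (a c : Z -> R) (t : R) : R := zsum (fun s => c s * exp (a s * t)).
Definition csum (a c : Z -> R) (t : R) : R := zsum (fun s => c s * cos (a s * t)).
Definition ssum (a c : Z -> R) (t : R) : R := zsum (fun s => c s * sin (a s * t)).

(** The condition is open in [t]; the room left around each [t] absorbs the factors [a s] produced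
    by differentiation. *)
Definition admissible (y : R) (a c : Z -> R) : Prop :=
  forall t, Rabs t < y -> zabs (fun s => c s * exp (a s * t)).

Lemma Rabs_le_exp_pm x : Rabs x <= exp x + exp (- x).
Proof.
  pose proof (exp_ineq1_le x). pose proof (exp_ineq1_le (- x)).
  pose proof (exp_pos x). pose proof (exp_pos (- x)).
  apply Rabs_le; lra.
Qed.

Lemma exp_Rabs_le x : exp (Rabs x) <= exp x + exp (- x).
Proof.
  pose proof (exp_pos x). pose proof (exp_pos (- x)).
  unfold Rabs; destruct (Rcase_abs x); lra.
Qed.

(** From [d * |a s| <= exp (a s * d) + exp (- (a s * d))], a factor [a s] costs only the passage
    from [t] to [t + d] and [t - d], both still in the interval. *)
Lemma admissible_mul y a c : admissible y a c -> admissible y a (fun s => a s * c s).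
Proof.
  intros H t Ht. set (d := (y - Rabs t) / 2). assert (Hd : 0 < d) by (unfold d; lra).
  assert (H1 : Rabs (t + d) < y).
  { eapply Rle_lt_trans; [apply Rabs_triang|]. rewrite (Rabs_pos_eq d) by lra. unfold d; lra. }
  assert (H2 : Rabs (t - d) < y).
  { unfold Rminus. eapply Rle_lt_trans; [apply Rabs_triang|].
    rewrite Rabs_Ropp, (Rabs_pos_eq d) by lra. unfold d; lra. }
  apply zabs_le with (fun s => / d * (Rabs (c s * exp (a s * (t + d))) + Rabs (c s * exp (a s * (t - d))))).
  - intros s. rewrite !Rabs_mult, !(Rabs_pos_eq (exp _)) by (left; apply exp_pos).
    replace (a s * (t + d)) with (a s * t + a s * d) by ring.
    replace (a s * (t - d)) with (a s * t + - (a s * d)) by ring.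
    rewrite !exp_plus.
    apply Rmult_le_reg_l with d; [exact Hd|].
    rewrite <- (Rmult_assoc d (/ d)), Rinv_r, Rmult_1_l by lra.
    pose proof (Rabs_le_exp_pm (a s * d)) as K. rewrite Rabs_mult, (Rabs_pos_eq d) in K by lra.
    pose proof (Rmult_le_pos _ _ (Rabs_pos (c s)) (Rlt_le _ _ (exp_pos (a s * t)))) as P.
    pose proof (Rmult_le_compat_l _ _ _ P K). lra.
  - eexists. apply is_zsum_scal, is_zsum_plus; apply zabs_correct, zabs_Rabs; auto.
Qed.

Lemma admissible_scal y a c k : admissible y a c -> admissible y a (fun s => k * c s).
Proof.
  intros H t Ht. apply zabs_ext with (fun s => k * (c s * exp (a s * t))); [intros; ring|].
  apply zabs_scal; auto.
Qed.

Lemma admissible_plus y a c d :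
  admissible y a c -> admissible y a d -> admissible y a (fun s => c s + d s).
Proof.
  intros H1 H2 t Ht.
  apply zabs_ext with (fun s => c s * exp (a s * t) + d s * exp (a s * t)); [intros; ring|].
  apply zabs_plus; auto.
Qed.

Lemma admissible_ext y a c d : (forall s, c s = d s) -> admissible y a c -> admissible y a d.
Proof. intros E H t Ht. apply zabs_ext with (2 := H t Ht). intros; now rewrite E. Qed.

Lemma esum_ext a c d t : (forall s, c s = d s) -> esum a c t = esum a d t.
Proof. intros E. apply zsum_ext; intros; now rewrite E. Qed.

Lemma admissible_zabs y a c : 0 < y -> admissible y a c -> zabs c.
Proof.
  intros Hy H. apply zabs_ext with (2 := H 0 ltac:(rewrite Rabs_R0; exact Hy)).
  intros s; simpl. now rewrite Rmult_0_r, exp_0, Rmult_1_r.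
Qed.

Lemma exp_taylor1 z : Rabs (exp z - 1 - z) <= z ^ 2 * exp (Rabs z).
Proof.
  pose proof (exp_ineq1_le z). pose proof (exp_ineq1_le (- z)). pose proof (exp_pos z).
  assert (E : exp z * exp (- z) = 1) by (rewrite <- exp_plus, Rplus_opp_r; apply exp_0).
  rewrite Rabs_pos_eq by lra.
  unfold Rabs; destruct (Rcase_abs z).
  - assert (exp z * (1 - z) <= 1) by nra.
    assert (exp z - 1 - z <= z ^ 2) by nra.
    assert (1 <= exp (- z)) by lra. nra.
  - assert (exp z - 1 <= z * exp z) by nra. nra.
Qed.

(** The remainder of [exp] is at most [(a h)^2 * exp |a h|]. Replacing [h] by [d] in the exponential
    and splitting [exp |a d|] into its two signs gives the series at [t + d] and [t - d] with
    coefficients [a^2 c], which are summable. *)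
Lemma esum_derive y a c t : admissible y a c -> Rabs t < y ->
  is_derive (esum a c) t (esum a (fun s => a s * c s) t).
Proof.
  intros H Ht. set (d := (y - Rabs t) / 2). assert (Hd : 0 < d) by (unfold d; lra).
  assert (H1 : forall h, Rabs h <= d -> Rabs (t + h) < y).
  { intros h Hh. eapply Rle_lt_trans; [apply Rabs_triang|]. unfold d in *; lra. }
  pose proof (admissible_mul _ _ _ (admissible_mul _ _ _ H)) as H2.
  apply (zsum_derive (fun s t => c s * exp (a s * t)) _
    (fun s => Rabs (a s * (a s * c s) * exp (a s * (t + d))) + Rabs (a s * (a s * c s) * exp (a s * (t + - d)))) t d Hd).
  - intros h Hh. apply H, H1. lra.
  - exact (admissible_mul _ _ _ H t Ht).
  - apply zabs_plus; apply zabs_Rabs, H2, H1; rewrite ?Rabs_Ropp, Rabs_pos_eq; lra.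
  - intros h s Hh.
    replace (c s * exp (a s * (t + h)) - c s * exp (a s * t) - h * (a s * c s * exp (a s * t)))
      with (c s * exp (a s * t) * (exp (a s * h) - 1 - a s * h))
      by (rewrite Rmult_plus_distr_l, exp_plus; ring).
    rewrite !Rmult_plus_distr_l, !exp_plus, !Rabs_mult, !(Rabs_pos_eq (exp _)) by (left; apply exp_pos).
    rewrite <- Rmult_plus_distr_l.
    apply Rle_trans with (Rabs (c s) * exp (a s * t) * ((a s * h) ^ 2 * exp (Rabs (a s * d)))).
    + apply Rmult_le_compat_l; [apply Rmult_le_pos; [apply Rabs_pos|left; apply exp_pos]|].
      eapply Rle_trans; [apply exp_taylor1|].
      apply Rmult_le_compat_l; [apply pow2_ge_0|].
      (destruct (Req_dec (Rabs (a s * h)) (Rabs (a s * d))) as [->|Hn]; [lra|]).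
      left; apply exp_increasing. rewrite !Rabs_mult in *. rewrite (Rabs_pos_eq d) in * by lra.
      pose proof (Rmult_le_compat_l _ _ _ (Rabs_pos (a s)) (Rlt_le _ _ Hh)). lra.
    + pose proof (exp_Rabs_le (a s * d)) as K.
      replace (a s * - d) with (- (a s * d)) by ring.
      replace ((a s * h) ^ 2) with (h ^ 2 * (Rabs (a s) * Rabs (a s))).
      2:{ rewrite <- (pow2_abs (a s * h)), <- (pow2_abs h), Rabs_mult. ring. }
      pose proof (Rabs_pos (a s)). pose proof (Rabs_pos (c s)).
      pose proof (exp_pos (a s * t)). pose proof (pow2_ge_0 h).
      assert (P : 0 <= Rabs (c s) * exp (a s * t) * (h ^ 2 * (Rabs (a s) * Rabs (a s)))).
      { apply Rmult_le_pos; [apply Rmult_le_pos; lra|]. apply Rmult_le_pos; [lra|]. apply Rmult_le_pos; lra. }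
      pose proof (Rmult_le_compat_l _ _ _ P K). lra.
Qed.

(** Termwise differentiation needs only the order [h^2]. The bound comes from [1 - cos x <= 2 x] and
    the mean value theorem for [z^2 - (z - sin z)]. *)
Lemma sin_taylor1 h : Rabs (sin h - h) <= h ^ 2.
Proof.
  assert (cs : forall x, 0 <= x -> 1 - cos x <= 2 * x).
  { intros x Hx. replace x with (2 * (x / 2)) at 1 by field. rewrite cos_2a_sin.
    assert (0 <= x / 2) by lra. 
    assert (sin (x / 2) * sin (x / 2) <= 1 * Rabs (sin (x/2))).
    { rewrite <- (Rabs_pos_eq (sin (x/2) * sin (x/2))), Rabs_mult by nra.
      apply Rmult_le_compat_r; [apply Rabs_pos|]. apply Rabs_le, SIN_bound. }
    assert (Rabs (sin (x / 2)) <= x / 2).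
    { destruct (Rle_lt_dec PI (x/2)) as [Hp|Hp].
      - pose proof PI2_1. apply Rle_trans with 1; [apply Rabs_le, SIN_bound|lra].
      - rewrite Rabs_pos_eq; [|apply sin_ge_0; lra].
        destruct (Req_dec (x/2) 0) as [->|]; [rewrite sin_0; lra|]. left; apply sin_lt_x; lra. }
    lra. }
  assert (P : forall x, 0 <= x -> 0 <= x - sin x <= x ^ 2).
  { intros x Hx. destruct (Req_dec x 0) as [->|Hx0]; [rewrite sin_0; lra|]. split.
    - assert (sin x < x) by (apply sin_lt_x; lra). lra.
    - destruct (MVT_gen (fun z => z ^ 2 - (z - sin z)) 0 x (fun z => 2 * z - (1 - cos z))) as [c [Hc E]].
      + intros z _. auto_derive; [trivial|ring].
      + intros z _. apply derivable_continuous_pt. exists (2 * z - (1 - cos z)).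
        apply is_derive_Reals. auto_derive; [trivial|ring].
      + rewrite Rmin_left, Rmax_right in Hc by lra. rewrite sin_0 in E.
        specialize (cs c ltac:(lra)). nra. }
  destruct (Rle_lt_dec 0 h) as [Hh|Hh].
  - specialize (P h Hh). apply Rabs_le; lra.
  - specialize (P (- h) ltac:(lra)). rewrite sin_neg in P. apply Rabs_le. nra.
Qed.

Lemma cos_taylor1 h : Rabs (cos h - 1) <= h ^ 2.
Proof.
  replace h with (2 * (h / 2)) at 1 by field. rewrite cos_2a_sin.
  assert (Rabs (sin (h/2)) <= Rabs (h/2)).
  { assert (P : forall x, 0 <= x -> Rabs (sin x) <= x).
    { intros x Hx. destruct (Rle_lt_dec PI x) as [Hp|Hp].
      - pose proof PI2_1. apply Rle_trans with 1; [apply Rabs_le, SIN_bound|lra].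
      - rewrite Rabs_pos_eq; [|apply sin_ge_0; lra].
        destruct (Req_dec x 0) as [->|]; [rewrite sin_0; lra|]. left; apply sin_lt_x; lra. }
    destruct (Rle_lt_dec 0 (h/2)).
    - rewrite (Rabs_pos_eq (h/2)) by lra. auto.
    - rewrite <- Rabs_Ropp, <- sin_neg, (Rabs_left (h/2)) by lra. apply P; lra. }
  assert (E : sin (h/2) * sin (h/2) <= (h/2)*(h/2)).
  { rewrite <- (Rabs_pos_eq (sin _ * sin _)), <- (Rabs_pos_eq (h/2 * (h/2))), !Rabs_mult by nra.
    apply Rmult_le_compat; auto using Rabs_pos. }
  apply Rabs_le; nra.
Qed.

Lemma cos_sum_taylor1 x h : Rabs (cos (x + h) - cos x + h * sin x) <= 2 * h ^ 2.
Proof.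
  rewrite cos_plus.
  replace (cos x * cos h - sin x * sin h - cos x + h * sin x)
    with (cos x * (cos h - 1) + - sin x * (sin h - h)) by ring.
  eapply Rle_trans; [apply Rabs_triang|]. rewrite !Rabs_mult, Rabs_Ropp.
  pose proof (sin_taylor1 h). pose proof (cos_taylor1 h).
  assert (Rabs (cos x) <= 1) by apply Rabs_le, COS_bound.
  assert (Rabs (sin x) <= 1) by apply Rabs_le, SIN_bound.
  pose proof (Rabs_pos (cos x)). pose proof (Rabs_pos (sin x)).
  pose proof (Rabs_pos (cos h - 1)). pose proof (Rabs_pos (sin h - h)). nra.
Qed.

Lemma sin_sum_taylor1 x h : Rabs (sin (x + h) - sin x - h * cos x) <= 2 * h ^ 2.
Proof.
  (* The sine is the cosine translated by a quarter turn. *)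
  pose proof (cos_sum_taylor1 (x + - (PI / 2)) h) as K.
  replace (x + - (PI/2) + h) with (- (PI / 2 - (x + h))) in K by ring.
  replace (x + - (PI/2)) with (- (PI / 2 - x)) in K by ring.
  rewrite !cos_neg, sin_neg, !cos_shift, sin_shift in K.
  replace (sin (x + h) - sin x - h * cos x) with (sin (x + h) - sin x + h * - cos x) by ring.
  exact K.
Qed.

Lemma zabs_bounded_mul (c e : Z -> R) : (forall s, Rabs (e s) <= 1) -> zabs c -> zabs (fun s => c s * e s).
Proof.
  intros He. apply zabs_dom. intros s. rewrite Rabs_mult.
  specialize (He s). pose proof (Rabs_pos (c s)). nra.
Qed.

Lemma zabs_cos c (a : Z -> R) t : zabs c -> zabs (fun s => c s * cos (a s * t)).
Proof. apply zabs_bounded_mul. intros; apply Rabs_le, COS_bound. Qed.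

Lemma zabs_sin c (a : Z -> R) t : zabs c -> zabs (fun s => c s * sin (a s * t)).
Proof. apply zabs_bounded_mul. intros; apply Rabs_le, SIN_bound. Qed.

Lemma csum_derive a c t : zabs c -> zabs (fun s => a s * c s) -> zabs (fun s => a s * (a s * c s)) ->
  is_derive (csum a c) t (- ssum a (fun s => a s * c s) t).
Proof.
  intros H0 H1 H2. replace (- _) with (zsum (fun s => (-1) * (a s * c s * sin (a s * t)))).
  2:{ rewrite zsum_scal. unfold ssum; ring. }
  apply (zsum_derive (fun s t => c s * cos (a s * t)) _
     (fun s => 2 * Rabs (a s * (a s * c s))) t 1 Rlt_0_1).
  - intros h _. now apply zabs_cos.
  - apply zabs_scal. now apply (zabs_sin (fun s => a s * c s)).
  - now apply zabs_scal, zabs_Rabs.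
  - intros h s _.
    replace (c s * cos (a s * (t + h)) - c s * cos (a s * t) - h * (-1 * (a s * c s * sin (a s * t))))
      with (c s * (cos (a s * t + a s * h) - cos (a s * t) + (a s * h) * sin (a s * t)))
      by (rewrite (Rmult_plus_distr_l (a s)); ring).
    rewrite Rabs_mult. pose proof (cos_sum_taylor1 (a s * t) (a s * h)) as K.
    pose proof (Rmult_le_compat_l _ _ _ (Rabs_pos (c s)) K) as K2.
    rewrite <- (pow2_abs (a s * h)) in K2. rewrite <- (pow2_abs h).
    rewrite !Rabs_mult in *. eapply Rle_trans; [exact K2|]. right; ring.
Qed.

Lemma ssum_derive a c t : zabs c -> zabs (fun s => a s * c s) -> zabs (fun s => a s * (a s * c s)) ->
  is_derive (ssum a c) t (csum a (fun s => a s * c s) t).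
Proof.
  intros H0 H1 H2.
  apply (zsum_derive (fun s t => c s * sin (a s * t)) _
     (fun s => 2 * Rabs (a s * (a s * c s))) t 1 Rlt_0_1).
  - intros h _. now apply zabs_sin.
  - now apply (zabs_cos (fun s => a s * c s)).
  - now apply zabs_scal, zabs_Rabs.
  - intros h s _.
    replace (c s * sin (a s * (t + h)) - c s * sin (a s * t) - h * (a s * c s * cos (a s * t)))
      with (c s * (sin (a s * t + a s * h) - sin (a s * t) - (a s * h) * cos (a s * t)))
      by (rewrite (Rmult_plus_distr_l (a s)); ring).
    rewrite Rabs_mult. pose proof (sin_sum_taylor1 (a s * t) (a s * h)) as K.
    pose proof (Rmult_le_compat_l _ _ _ (Rabs_pos (c s)) K) as K2.
    rewrite <- (pow2_abs (a s * h)) in K2. rewrite <- (pow2_abs h).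
    rewrite !Rabs_mult in *. eapply Rle_trans; [exact K2|]. right; ring.
Qed.

(** * Products of exponential and trigonometric sums, parity, telescoping *)

Lemma esum_conv (a b d f g k : Z -> R) y t :
  (forall N s, a s + b (N - s)%Z = d N) ->
  (forall N, zsum (fun s => f s * g (N - s)%Z) = k N) -> admissible y a f -> admissible y b g -> Rabs t < y ->
  esum a f t * esum b g t = esum d k t.
Proof.
  intros Hd Hk Hf Hg Ht. symmetry. apply is_zsum_unique.
  eapply is_zsum_ext; [|exact (zsum_conv _ _ (Hf t Ht) (Hg t Ht))].
  intros N; simpl. rewrite <- Hk, Rmult_comm, <- zsum_scal. apply zsum_ext; intros s.
  rewrite <- (Hd N s), Rmult_plus_distr_r, exp_plus. ring.
Qed.

(** Taking both products together produces [cos (A + B)] under the convolution, hence a single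
    frequency [d N]; in each use parity kills one of the two products. *)
Lemma csum_conv (a b d f g k : Z -> R) t :
  (forall N s, a s + b (N - s)%Z = d N) ->
  (forall N, zsum (fun s => f s * g (N - s)%Z) = k N) -> zabs f -> zabs g ->
  csum a f t * csum b g t - ssum a f t * ssum b g t = csum d k t.
Proof.
  intros Hd Hk Hf Hg. symmetry. apply is_zsum_unique.
  eapply is_zsum_ext; [|exact (is_zsum_minus _ _ _ _
    (zsum_conv _ _ (zabs_cos f a t Hf) (zabs_cos g b t Hg))
    (zsum_conv _ _ (zabs_sin f a t Hf) (zabs_sin g b t Hg)))].
  intros N; simpl. rewrite <- Hk, Rmult_comm, <- zsum_scal.
  rewrite <- zsum_minus.
  - apply zsum_ext; intros s. rewrite <- (Hd N s), Rmult_plus_distr_r, cos_plus. ring.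
  - apply (zabs_conv _ (fun s => g s * cos (b s * t))); auto using zabs_cos.
  - apply (zabs_conv _ (fun s => g s * sin (b s * t))); auto using zabs_sin.
Qed.

Lemma ssum_conv (a b d f g k : Z -> R) t :
  (forall N s, a s + b (N - s)%Z = d N) ->
  (forall N, zsum (fun s => f s * g (N - s)%Z) = k N) -> zabs f -> zabs g ->
  ssum a f t * csum b g t + csum a f t * ssum b g t = ssum d k t.
Proof.
  intros Hd Hk Hf Hg. symmetry. apply is_zsum_unique.
  eapply is_zsum_ext; [|exact (is_zsum_plus _ _ _ _
    (zsum_conv _ _ (zabs_sin f a t Hf) (zabs_cos g b t Hg))
    (zsum_conv _ _ (zabs_cos f a t Hf) (zabs_sin g b t Hg)))].
  intros N; simpl. rewrite <- Hk, Rmult_comm, <- zsum_scal.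
  rewrite <- zsum_plus.
  - apply zsum_ext; intros s. rewrite <- (Hd N s), Rmult_plus_distr_r, sin_plus. ring.
  - apply (zabs_conv _ (fun s => g s * cos (b s * t))); auto using zabs_cos, zabs_sin.
  - apply (zabs_conv _ (fun s => g s * sin (b s * t))); auto using zabs_cos, zabs_sin.
Qed.

(** Reflection [s -> k - s] negates the frequencies, so with even coefficients the sine sum equals
    its own negative. For half-integers the reflection constant is [k = 1]. *)
Lemma ssum_even_coef a c k t : zabs c -> (forall s, a (k - s)%Z = - a s) ->
  (forall s, c (k - s)%Z = c s) -> ssum a c t = 0.
Proof.
  intros H Ha Hc. assert (E : ssum a c t = - ssum a c t); [|lra].
  unfold ssum at 1. destruct (zsum_reflect _ k (zabs_sin c a t H)) as [_ <-].
  replace (- ssum a c t) with ((-1) * ssum a c t) by ring. unfold ssum. rewrite <- zsum_scal.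
  apply zsum_ext; intros s. rewrite Ha, Hc.
  replace (- a s * t) with (- (a s * t)) by ring. rewrite sin_neg. ring.
Qed.

Lemma csum_odd_coef a c k t : zabs c -> (forall s, a (k - s)%Z = - a s) ->
  (forall s, c (k - s)%Z = - c s) -> csum a c t = 0.
Proof.
  intros H Ha Hc. assert (E : csum a c t = - csum a c t); [|lra].
  unfold csum at 1. destruct (zsum_reflect _ k (zabs_cos c a t H)) as [_ <-].
  replace (- csum a c t) with ((-1) * csum a c t) by ring. unfold csum. rewrite <- zsum_scal.
  apply zsum_ext; intros s. rewrite Ha, Hc.
  replace (- a s * t) with (- (a s * t)) by ring. rewrite cos_neg. ring.
Qed.

(* [I (S+1) - I S = 2] by telescoping, and reflecting [s] to [al - s] gives [I (al + be - S) = - I S]. *)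
Lemma zsum_telescope (A B : Z -> R) (al be S : Z) :
  (forall S, zabs (fun s => A s + B (S - s)%Z)) ->
  (forall s, A (al - s)%Z = - A s) -> (forall s, B (be - s)%Z = - B s) ->
  (forall S, is_lim_seq (fun n => B (S + Z.of_nat n)%Z) 1) ->
  zsum (fun s => A s + B (S - s)%Z) = 2 * IZR S - IZR (al + be).
Proof.
  intros Hz HA HB HL. pose (I := fun S => zsum (fun s => A s + B (S - s)%Z)).
  assert (step : forall S, I (S + 1)%Z = I S + 2).
  { intros T. enough (I (T + 1)%Z - I T = 2) by lra. unfold I.
    rewrite <- zsum_minus by auto. apply is_zsum_unique.
    apply is_zsum_ext with (fun s => B (T + 1 - s)%Z - B (T - s)%Z); [intros; ring|].
    (* The first [n + 1] pairs cover [s = -n-1, ..., n], so the sum collapses to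
       [B (T + 2 + n) - B (T - n)]; antisymmetry rewrites the second value, and both terms then tend
       to [1]. *)
    assert (P : forall n, sum_n (zs (fun s => B (T + 1 - s)%Z - B (T - s)%Z)) n =
               B (T + 2 + Z.of_nat n)%Z + B (be - T + Z.of_nat n)%Z).
    { induction n.
      - rewrite sum_O. unfold zs.
        replace (be - T + Z.of_nat 0)%Z with (be - T)%Z by lia. rewrite HB.
        replace (T + 1 - Z.of_nat 0)%Z with (T + 1)%Z by lia.
        replace (T - Z.of_nat 0)%Z with T by lia.
        replace (T + 1 - (- Z.of_nat 0 - 1))%Z with (T + 2)%Z by lia.
        replace (T - (- Z.of_nat 0 - 1))%Z with (T + 1)%Z by lia.
        replace (T + 2 + Z.of_nat 0)%Z with (T + 2)%Z by lia.
        match goal with |- ?p = ?q => change (@eq R p q) end. ring.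
      - rewrite sum_Sn, IHn. unfold plus; cbn -[Z.of_nat]. unfold zs.
        replace (be - T + Z.of_nat n)%Z with (be - (T - Z.of_nat n))%Z by lia.
        replace (be - T + Z.of_nat (Datatypes.S n))%Z with (be - (T - Z.of_nat (Datatypes.S n)))%Z by lia.
        rewrite !HB.
        replace (T + 1 - Z.of_nat (Datatypes.S n))%Z with (T - Z.of_nat n)%Z by lia.
        replace (T + 1 - (- Z.of_nat (Datatypes.S n) - 1))%Z with (T + 2 + Z.of_nat (Datatypes.S n))%Z by lia.
        replace (T - (- Z.of_nat (Datatypes.S n) - 1))%Z with (T + 2 + Z.of_nat n)%Z by lia.
        match goal with |- ?p = ?q => change (@eq R p q) end. ring. }
    eapply filterlim_ext; [intros n; symmetry; apply P|].
    replace 2 with (1 + 1) by ring. apply (is_lim_seq_plus' _ _ 1 1); apply HL. }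
  assert (lin : forall n : nat, forall S, I (S + Z.of_nat n)%Z = I S + 2 * INR n).
  { induction n; intros T.
    - replace (T + Z.of_nat 0)%Z with T by lia. simpl; ring.
    - replace (T + Z.of_nat (Datatypes.S n))%Z with ((T + Z.of_nat n) + 1)%Z by lia.
      rewrite step, IHn, S_INR. ring. }
  assert (linZ : forall S, I S = I 0%Z + 2 * IZR S).
  { intros T. destruct (Z_le_gt_dec 0 T).
    - replace T with (0 + Z.of_nat (Z.to_nat T))%Z by lia. rewrite lin, Z.add_0_l, INR_IZR_INZ. ring.
    - pose proof (lin (Z.to_nat (- T)) T) as L. rewrite INR_IZR_INZ, Z2Nat.id in L by lia.
      replace (T + - T)%Z with 0%Z in L by lia. rewrite L, opp_IZR. ring. }
  assert (anti : I 0%Z = - I (al + be)%Z).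
  { unfold I at 1. destruct (zsum_reflect _ al (Hz 0%Z)) as [_ <-].
    replace (- I (al + be)%Z) with ((-1) * I (al + be)%Z) by ring. unfold I. rewrite <- zsum_scal.
    apply zsum_ext; intros s. rewrite HA.
    replace (0 - (al - s))%Z with (be - (al + be - s))%Z by lia. rewrite HB. ring. }
  rewrite linZ in anti. fold (I S). rewrite linZ. specialize (linZ (al + be)%Z). lra.
Qed.

(** * The three coefficient sequences and their convolutions *)

Definition half (s : Z) : R := IZR s - / 2.
Definition fc (y : R) (s : Z) : R := / cosh (half s * y).
Definition gc (y : R) (s : Z) : R := / cosh (IZR s * y).
Definition hc (y : R) (s : Z) : R := / sinh (half s * y).

(** The decay of the coefficients beats the growth of [exp (a s * t)] by the rate [e = y - |t|], so
    the comparison series is geometric with ratio [exp (- e)]; [D] pays for replacing [a s] by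
    [s]. *)
Lemma admissible_of_decay y a c C D :
  (forall s, Rabs (a s - IZR s) <= D) -> (forall s, Rabs (c s) <= C * exp (- Rabs (a s) * y)) ->
  admissible y a c.
Proof.
  intros Ha Hc t Ht. set (e := y - Rabs t). assert (He : 0 < e) by (unfold e; lra).
  assert (HC : 0 <= C).
  { specialize (Hc 0%Z). pose proof (Rabs_pos (c 0%Z)). pose proof (exp_pos (- Rabs (a 0%Z) * y)).
    destruct (Rle_lt_dec 0 C); [assumption|]. nra. }
  apply zabs_le with (fun s => C * exp (D * e) * exp (- e * Rabs (IZR s))).
  - intros s. rewrite Rabs_mult, (Rabs_pos_eq (exp _)) by (left; apply exp_pos).
    apply Rle_trans with (C * exp (- Rabs (a s) * y) * exp (a s * t)).
    { apply Rmult_le_compat_r; [left; apply exp_pos|apply Hc]. }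
    rewrite !Rmult_assoc, <- !exp_plus. apply Rmult_le_compat_l; [exact HC|].
    assert (L : - Rabs (a s) * y + a s * t <= D * e + - e * Rabs (IZR s)).
    { assert (a s * t <= Rabs (a s) * Rabs t) by (rewrite <- Rabs_mult; apply Rle_abs).
      assert (Rabs (IZR s) <= Rabs (a s) + D).
      { specialize (Ha s). rewrite Rabs_minus_sym in Ha.
        replace (IZR s) with (a s + (IZR s - a s)) by ring.
        eapply Rle_trans; [apply Rabs_triang|]. lra. }
      unfold e in *. nra. }
    destruct L as [L| ->]; [left; now apply exp_increasing|apply Rle_refl].
  - assert (Hr : 0 < exp (- e) < 1).
    { split; [apply exp_pos|]. rewrite <- exp_0. apply exp_increasing; lra. }
    apply ex_series_ext with (fun j => (C * exp (D * e) * (1 + exp (- e))) * exp (- e) ^ j).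
    + intros j. unfold zs. rewrite Rabs_pos_eq by (apply IZR_le; lia).
      rewrite Rabs_left1 by (apply IZR_le; lia).
      rewrite minus_IZR, opp_IZR, <- INR_IZR_INZ.
      replace (- e * - (- INR j - 1)) with (- e + - e * INR j) by ring. rewrite exp_plus.
      assert (E : exp (- e * INR j) = exp (- e) ^ j).
      { induction j; [simpl; rewrite Rmult_0_r, exp_0; reflexivity|].
        rewrite S_INR, Rmult_plus_distr_l, exp_plus, IHj, Rmult_1_r. simpl; ring. }
      rewrite E. match goal with |- ?p = ?q => change (@eq R p q) end. ring.
    + eexists. refine (is_series_scal (C * exp (D * e) * (1 + exp (- e))) _ _ (is_series_geom (exp (- e)) _)).
      rewrite Rabs_pos_eq; lra.
Qed.

Lemma cosh_pos x : 0 < cosh x.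
Proof. unfold cosh. pose proof (exp_pos x). pose proof (exp_pos (- x)). lra. Qed.

Lemma cosh_Ropp x : cosh (- x) = cosh x.
Proof. unfold cosh. rewrite Ropp_involutive. lra. Qed.

Lemma sinh_Ropp x : sinh (- x) = - sinh x.
Proof. unfold sinh. rewrite Ropp_involutive. lra. Qed.

Lemma sinh_add x z : sinh (x + z) = sinh x * cosh z + cosh x * sinh z.
Proof. unfold sinh, cosh. rewrite Ropp_plus_distr, !exp_plus. field. Qed.

Lemma cosh_add x z : cosh (x + z) = cosh x * cosh z + sinh x * sinh z.
Proof. unfold sinh, cosh. rewrite Ropp_plus_distr, !exp_plus. field. Qed.

Lemma sinh_pos x : 0 < x -> 0 < sinh x.
Proof. intros H. unfold sinh. assert (exp (- x) < exp x) by (apply exp_increasing; lra). lra. Qed.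

Lemma sinh_neq0 x : x <> 0 -> sinh x <> 0.
Proof.
  intros H. destruct (Rlt_le_dec 0 x) as [K|K].
  - pose proof (sinh_pos x K); lra.
  - pose proof (sinh_pos (- x) ltac:(lra)). rewrite sinh_Ropp in *; lra.
Qed.

Lemma half_neq0 s : half s <> 0.
Proof.
  unfold half. intros H. assert (E : IZR (2 * s) = IZR 1) by (rewrite mult_IZR; lra).
  apply eq_IZR in E. lia.
Qed.

Lemma half_Rabs s : / 2 <= Rabs (half s).
Proof.
  unfold half. destruct (Z_le_gt_dec s 0) as [H|H].
  - apply IZR_le in H. rewrite Rabs_left1; lra.
  - assert (1 <= IZR s) by (apply IZR_le; lia). rewrite Rabs_pos_eq; lra.
Qed.

Lemma half_opp s : half (1 - s) = - half s.
Proof. unfold half. rewrite minus_IZR. lra. Qed.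

Lemma cosh_inv_decay x y : 0 < y -> Rabs (/ cosh (x * y)) <= 2 * exp (- Rabs x * y).
Proof.
  intros Hy. rewrite Rabs_inv, (Rabs_pos_eq (cosh _)) by (left; apply cosh_pos).
  replace (2 * exp (- Rabs x * y)) with (/ (exp (Rabs x * y) / 2)).
  2:{ replace (- Rabs x * y) with (- (Rabs x * y)) by ring. rewrite exp_Ropp. field.
      apply Rgt_not_eq, exp_pos. }
  apply Rinv_le_contravar; [pose proof (exp_pos (Rabs x * y)); lra|].
  unfold cosh. replace (Rabs x * y) with (Rabs (x * y)) by (rewrite Rabs_mult, (Rabs_pos_eq y); lra).
  pose proof (exp_Rabs_le (x * y)). lra.
Qed.

Lemma admissible_fc y : 0 < y -> admissible y half (fc y).
Proof.
  intros Hy. apply admissible_of_decay with (C := 2) (D := / 2).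
  - intros s. unfold half. replace (IZR s - / 2 - IZR s) with (- / 2) by ring.
    rewrite Rabs_Ropp, Rabs_pos_eq; lra.
  - intros s. now apply cosh_inv_decay.
Qed.

Lemma admissible_gc y : 0 < y -> admissible y IZR (gc y).
Proof.
  intros Hy. apply admissible_of_decay with (C := 2) (D := / 2).
  - intros s. rewrite Rminus_diag, Rabs_R0. lra.
  - intros s. now apply cosh_inv_decay.
Qed.

Lemma admissible_hc y : 0 < y -> admissible y half (hc y).
Proof.
  intros Hy. assert (Hr : exp (- y) < 1) by (rewrite <- exp_0; apply exp_increasing; lra).
  (* As [|half s| >= 1/2], the argument [z] satisfies [2 z >= y], hence
     [sinh z >= exp z * (1 - exp (- y)) / 2]. *)
  apply admissible_of_decay with (C := 2 / (1 - exp (- y))) (D := / 2).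
  - intros s. unfold half. replace (IZR s - / 2 - IZR s) with (- / 2) by ring.
    rewrite Rabs_Ropp, Rabs_pos_eq; lra.
  - intros s. unfold hc. set (x := half s). pose proof (half_Rabs s) as Hx. fold x in Hx.
    set (z := Rabs x * y). assert (Hz : y <= 2 * z) by (unfold z; nra).
    assert (E : Rabs (sinh (x * y)) = sinh z).
    { unfold z, Rabs at 2. destruct (Rcase_abs x).
      - rewrite <- Rabs_Ropp, <- sinh_Ropp, Rabs_pos_eq; [f_equal; ring|].
        left; apply sinh_pos; nra.
      - rewrite Rabs_pos_eq; [reflexivity|]. left; apply sinh_pos.
        rewrite Rabs_pos_eq in Hx by lra. nra. }
    rewrite Rabs_inv, E.
    replace (2 / (1 - exp (- y)) * exp (- Rabs x * y)) with (/ (exp z * (1 - exp (- y)) / 2)).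
    2:{ replace (- Rabs x * y) with (- z) by (unfold z; ring). rewrite (exp_Ropp z). field.
        split; [apply Rgt_not_eq, exp_pos|lra]. }
    pose proof (exp_pos z).
    apply Rinv_le_contravar; [nra|].
    unfold sinh. assert (exp (- z) <= exp z * exp (- y)).
    { rewrite <- exp_plus. destruct (Req_dec (- z) (z + - y)) as [->|]; [lra|].
      left; apply exp_increasing; lra. }
    nra.
Qed.

(** * Evaluation of the convolutions *)

Definition coth (x : R) : R := cosh x / sinh x.

Lemma tanh_Ropp x : tanh (- x) = - tanh x.
Proof. unfold tanh. rewrite sinh_Ropp, cosh_Ropp. unfold Rdiv; ring. Qed.

Lemma coth_Ropp x : coth (- x) = - coth x.
Proof. unfold coth. rewrite sinh_Ropp, cosh_Ropp. unfold Rdiv. rewrite Rinv_opp; ring. Qed.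

Lemma exp_seq_infty y o : 0 < y -> is_lim_seq (fun n => exp (2 * ((INR n + o) * y))) p_infty.
Proof.
  intros Hy. apply is_lim_seq_le_p_loc with (fun n => 2 * (INR n + o) * y).
  - exists 0%nat. intros n _.
    pose proof (exp_ineq1_le (2 * ((INR n + o) * y))). lra.
  - replace p_infty with (Rbar_mult (Rbar_mult 2 (Rbar_plus p_infty o)) y).
    + apply is_lim_seq_scal_r, is_lim_seq_scal_l.
      apply is_lim_seq_plus with p_infty o.
      * apply is_lim_seq_INR.
      * apply is_lim_seq_const.
      * reflexivity.
    + simpl. destruct (Rle_dec 0 2) as [H2|]; [|exfalso; lra].
      destruct (Rle_lt_or_eq_dec 0 2 H2); [|exfalso; lra]. simpl.
      destruct (Rle_dec 0 y) as [H|]; [|exfalso; lra].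
      destruct (Rle_lt_or_eq_dec 0 y H); [reflexivity|exfalso; lra].
Qed.

Lemma tanh_lim y o : 0 < y -> is_lim_seq (fun n => tanh ((INR n + o) * y)) 1.
Proof.
  intros Hy.
  apply is_lim_seq_ext with (fun n => 1 + -2 * / (exp (2 * ((INR n + o) * y)) + 1)).
  - intros n. set (x := (INR n + o) * y). unfold tanh, sinh, cosh.
    rewrite exp_Ropp. replace (2 * x) with (x + x) by ring. rewrite exp_plus.
    pose proof (exp_pos x). field. repeat split; nra.
  - replace (Finite 1) with (Finite (1 + -2 * 0)) by (f_equal; ring).
    apply is_lim_seq_plus'; [apply is_lim_seq_const|].
    apply (is_lim_seq_scal_l _ (-2) 0).
    replace (Finite 0) with (Rbar_inv p_infty) by reflexivity.
    apply is_lim_seq_inv; [|discriminate].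
    apply is_lim_seq_plus with p_infty 1; [now apply exp_seq_infty|apply is_lim_seq_const|reflexivity].
Qed.

Lemma sinh_tanh x z : sinh (x + z) * (/ cosh x * / cosh z) = tanh x + tanh z.
Proof.
  unfold tanh. rewrite sinh_add. pose proof (cosh_pos x). pose proof (cosh_pos z). field; lra.
Qed.

Lemma cosh_tanh x z : x <> 0 -> cosh (x + z) * (/ sinh x * / cosh z) = coth x + tanh z.
Proof.
  intros Hx. unfold tanh, coth. rewrite cosh_add. pose proof (sinh_neq0 x Hx). pose proof (cosh_pos z).
  field; lra.
Qed.

Lemma zabs_fc y : 0 < y -> zabs (fc y).
Proof. intros Hy. exact (admissible_zabs _ _ _ Hy (admissible_fc y Hy)). Qed.
Lemma zabs_gc y : 0 < y -> zabs (gc y).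
Proof. intros Hy. exact (admissible_zabs _ _ _ Hy (admissible_gc y Hy)). Qed.
Lemma zabs_hc y : 0 < y -> zabs (hc y).
Proof. intros Hy. exact (admissible_zabs _ _ _ Hy (admissible_hc y Hy)). Qed.

Lemma half_mul_neq0 y s : 0 < y -> half s * y <> 0.
Proof. intros Hy. apply Rmult_integral_contrapositive; split; [apply half_neq0|lra]. Qed.

Lemma tanh_half_lim y S : 0 < y -> is_lim_seq (fun n => tanh (half (S + Z.of_nat n) * y)) 1.
Proof.
  intros Hy.
  eapply is_lim_seq_ext; [|exact (tanh_lim y (IZR S - / 2) Hy)].
  intros n. unfold half. rewrite plus_IZR, <- INR_IZR_INZ. do 2 f_equal. ring.
Qed.

Lemma tanh_int_lim y S : 0 < y -> is_lim_seq (fun n => tanh (IZR (S + Z.of_nat n) * y)) 1.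
Proof.
  intros Hy.
  eapply is_lim_seq_ext; [|exact (tanh_lim y (IZR S) Hy)].
  intros n. rewrite plus_IZR, <- INR_IZR_INZ. do 2 f_equal. ring.
Qed.

(** Multiplying by [sinh (half N * y)], independent of [s], turns each term into a sum of two
    hyperbolic tangents. The reflection constants are 1 for half-integers and 0 for integers, so the
    telescoped value is [2 N - 1 = 2 * half N]. *)
Lemma conv_fg y N : 0 < y -> zsum (fun s => fc y s * gc y (N - s)) = half N * (2 * hc y N).
Proof.
  intros Hy.
  pose proof (sinh_neq0 _ (half_mul_neq0 y N Hy)) as K.
  assert (E : forall M s, sinh (half M * y) * (fc y s * gc y (M - s)) = tanh (half s * y) + tanh (IZR (M - s) * y)).
  { intros M s. unfold fc, gc. rewrite <- sinh_tanh. f_equal. f_equal. unfold half. rewrite minus_IZR. ring. }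
  assert (T : zsum (fun s => tanh (half s * y) + tanh (IZR (N - s) * y)) = 2 * IZR N - IZR (1 + 0)).
  { apply (zsum_telescope (fun s => tanh (half s * y)) (fun s => tanh (IZR s * y))).
    (* Hyperbolic tangents do not decay; the summability of their sum is read off from the product
       form. *)
    - intros M. apply zabs_ext with (1 := E M). apply zabs_scal, zabs_conv; auto using zabs_fc, zabs_gc, zabs_hc.
    - intros s. rewrite half_opp, <- tanh_Ropp. f_equal; ring.
    - intros s. rewrite minus_IZR, <- tanh_Ropp. f_equal; ring.
    - now intros; apply tanh_int_lim. }
  rewrite <- (zsum_ext _ _ (E N)), zsum_scal in T.
  apply Rmult_eq_reg_l with (2 := K). rewrite T.
  unfold hc. replace (2 * IZR N - IZR (1 + 0)) with (2 * half N) by (unfold half; simpl; field). field. exact K.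
Qed.

Lemma conv_hg y N : 0 < y -> zsum (fun s => hc y s * gc y (N - s)) = half N * (2 * fc y N).
Proof.
  intros Hy.
  pose proof (cosh_pos (half N * y)) as K.
  assert (E : forall M s, cosh (half M * y) * (hc y s * gc y (M - s)) = coth (half s * y) + tanh (IZR (M - s) * y)).
  { intros M s. unfold hc, gc. rewrite <- cosh_tanh by now apply half_mul_neq0. f_equal. f_equal. unfold half. rewrite minus_IZR. ring. }
  assert (T : zsum (fun s => coth (half s * y) + tanh (IZR (N - s) * y)) = 2 * IZR N - IZR (1 + 0)).
  { apply (zsum_telescope (fun s => coth (half s * y)) (fun s => tanh (IZR s * y))).
    - intros M. apply zabs_ext with (1 := E M). apply zabs_scal, zabs_conv; auto using zabs_fc, zabs_gc, zabs_hc.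
    - intros s. rewrite half_opp, <- coth_Ropp. f_equal; ring.
    - intros s. rewrite minus_IZR, <- tanh_Ropp. f_equal; ring.
    - now intros; apply tanh_int_lim. }
  rewrite <- (zsum_ext _ _ (E N)), zsum_scal in T.
  apply Rmult_eq_reg_l with (cosh (half N * y)); [|lra]. rewrite T.
  unfold fc. replace (2 * IZR N - IZR (1 + 0)) with (2 * half N) by (unfold half; simpl; field). field. lra.
Qed.

(** Two half-integers add up to [N - 1], and both reflection constants are 1, whence [2 N - 2]. The
    index is shifted back when [Gr] and [Gi] are differentiated. *)
Lemma conv_hf y N : 0 < y -> zsum (fun s => hc y s * fc y (N - s)) = IZR (N - 1) * (2 * gc y (N - 1)).
Proof.
  intros Hy.
  pose proof (cosh_pos (IZR (N - 1) * y)) as K.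
  assert (E : forall M s, cosh (IZR (M - 1) * y) * (hc y s * fc y (M - s)) = coth (half s * y) + tanh (half (M - s) * y)).
  { intros M s. unfold hc, fc. rewrite <- cosh_tanh by now apply half_mul_neq0. f_equal. f_equal. unfold half. rewrite !minus_IZR. field. }
  assert (T : zsum (fun s => coth (half s * y) + tanh (half (N - s) * y)) = 2 * IZR N - IZR (1 + 1)).
  { apply (zsum_telescope (fun s => coth (half s * y)) (fun s => tanh (half s * y))).
    - intros M. apply zabs_ext with (1 := E M). apply zabs_scal, zabs_conv; auto using zabs_fc, zabs_gc, zabs_hc.
    - intros s. rewrite half_opp, <- coth_Ropp. f_equal; ring.
    - intros s. rewrite half_opp, <- tanh_Ropp. f_equal; ring.
    - now intros; apply tanh_half_lim. }
  rewrite <- (zsum_ext _ _ (E N)), zsum_scal in T.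
  apply Rmult_eq_reg_l with (cosh (IZR (N - 1) * y)); [|lra]. rewrite T.
  unfold gc. change (1 + 1)%Z with 2%Z. rewrite minus_IZR in *. field. lra.
Qed.

(** * The differential system *)

Definition Fr y := esum half (fc y).
Definition Gr y := esum IZR (gc y).
Definition Hr y := esum half (hc y).
(** [Fi], [Gi], [Hi] are the Fourier series of multiples of cn, dn, sn for the modulus
    [F0 y / G0 y], in the argument [G0 y * t / 2]. *)
Definition Fi y := csum half (fc y).
Definition Gi y := csum IZR (gc y).
Definition Hi y := ssum half (hc y).

Lemma half_add_int N s : half s + IZR (N - s) = half N.
Proof. unfold half. rewrite minus_IZR. ring. Qed.

Lemma half_add_half N s : half s + half (N - s) = IZR (N - 1).
Proof. unfold half. rewrite !minus_IZR. field. Qed.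

Lemma esum_double a c t : esum a (fun s => a s * (2 * c s)) t = 2 * esum a (fun s => a s * c s) t.
Proof. unfold esum. rewrite <- zsum_scal. apply zsum_ext; intros; ring. Qed.
Lemma csum_double a c t : csum a (fun s => a s * (2 * c s)) t = 2 * csum a (fun s => a s * c s) t.
Proof. unfold csum. rewrite <- zsum_scal. apply zsum_ext; intros; ring. Qed.
Lemma ssum_double a c t : ssum a (fun s => a s * (2 * c s)) t = 2 * ssum a (fun s => a s * c s) t.
Proof. unfold ssum. rewrite <- zsum_scal. apply zsum_ext; intros; ring. Qed.

Lemma Hr_derive y t : 0 < y -> Rabs t < y -> is_derive (Hr y) t (Fr y t * Gr y t / 2).
Proof.
  intros Hy Ht. replace (_ / 2) with (esum half (fun s => half s * hc y s) t).
  - apply (esum_derive y); [now apply admissible_hc|exact Ht].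
  - unfold Fr, Gr. rewrite (esum_conv _ _ _ _ _ _ y t half_add_int (fun N => conv_fg y N Hy)); auto using admissible_fc, admissible_gc.
    rewrite esum_double. field.
Qed.

Lemma Fr_derive y t : 0 < y -> Rabs t < y -> is_derive (Fr y) t (Hr y t * Gr y t / 2).
Proof.
  intros Hy Ht. replace (_ / 2) with (esum half (fun s => half s * fc y s) t).
  - apply (esum_derive y); [now apply admissible_fc|exact Ht].
  - unfold Hr, Gr. rewrite (esum_conv _ _ _ _ _ _ y t half_add_int (fun N => conv_hg y N Hy)); auto using admissible_hc, admissible_gc.
    rewrite esum_double. field.
Qed.

Lemma Gr_derive y t : 0 < y -> Rabs t < y -> is_derive (Gr y) t (Hr y t * Fr y t / 2).
Proof.
  intros Hy Ht. pose proof (admissible_gc y Hy) as Hg.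
  replace (_ / 2) with (esum IZR (fun s => IZR s * gc y s) t).
  - apply (esum_derive y); [exact Hg|exact Ht].
  - unfold Hr, Fr. rewrite (esum_conv _ _ _ _ _ _ y t half_add_half (fun N => conv_hf y N Hy)); auto using admissible_hc, admissible_fc.
    unfold esum at 2.
    rewrite (zsum_pred (fun s => IZR s * (2 * gc y s) * exp (IZR s * t))
       (admissible_mul _ _ _ (admissible_scal _ _ _ 2 Hg) t Ht)).
    fold (esum IZR (fun s => IZR s * (2 * gc y s)) t). rewrite esum_double. field.
Qed.

Lemma fc_even y s : fc y (1 - s) = fc y s.
Proof. unfold fc. rewrite half_opp, <- cosh_Ropp. do 2 f_equal; ring. Qed.
Lemma hc_odd y s : hc y (1 - s) = - hc y s.
Proof. unfold hc. rewrite half_opp, <- Rinv_opp, <- sinh_Ropp. do 2 f_equal; ring. Qed.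

Lemma zabs_mul1 y a c : 0 < y -> admissible y a c -> zabs (fun s => a s * c s).
Proof. intros Hy H. exact (admissible_zabs _ _ _ Hy (admissible_mul _ _ _ H)). Qed.
Lemma zabs_mul2 y a c : 0 < y -> admissible y a c -> zabs (fun s => a s * (a s * c s)).
Proof. intros Hy H. exact (admissible_zabs _ _ _ Hy (admissible_mul _ _ _ (admissible_mul _ _ _ H))). Qed.

Lemma ssum_fc y t : 0 < y -> ssum half (fc y) t = 0.
Proof. intros Hy. apply ssum_even_coef with 1%Z; auto using zabs_fc, half_opp, fc_even. Qed.
Lemma csum_hc y t : 0 < y -> csum half (hc y) t = 0.
Proof. intros Hy. apply csum_odd_coef with 1%Z; auto using zabs_hc, half_opp, hc_odd. Qed.

(** In the addition formula the product of sines contains the sine sum of the even sequence [fc],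
    which is zero; what remains is [Fi * Gi]. *)
Lemma Hi_derive y t : 0 < y -> is_derive (Hi y) t (Fi y t * Gi y t / 2).
Proof.
  intros Hy. pose proof (admissible_hc y Hy) as Hh.
  replace (_ / 2) with (csum half (fun s => half s * hc y s) t).
  - apply ssum_derive; eauto using zabs_hc, zabs_mul1, zabs_mul2.
  - pose proof (csum_conv _ _ _ _ _ _ t half_add_int (fun N => conv_fg y N Hy) (zabs_fc y Hy) (zabs_gc y Hy)) as E.
    rewrite csum_double, ssum_fc in E by exact Hy. unfold Fi, Gi. lra.
Qed.

Lemma Fi_derive y t : 0 < y -> is_derive (Fi y) t (- (Hi y t * Gi y t / 2)).
Proof.
  intros Hy. pose proof (admissible_fc y Hy) as Hh.
  replace (_ / 2) with (ssum half (fun s => half s * fc y s) t).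
  - apply csum_derive; eauto using zabs_fc, zabs_mul1, zabs_mul2.
  - pose proof (ssum_conv _ _ _ _ _ _ t half_add_int (fun N => conv_hg y N Hy) (zabs_hc y Hy) (zabs_gc y Hy)) as E.
    rewrite ssum_double, csum_hc in E by exact Hy. unfold Hi, Gi. lra.
Qed.

Lemma Gi_derive y t : 0 < y -> is_derive (Gi y) t (- (Hi y t * Fi y t / 2)).
Proof.
  intros Hy. pose proof (admissible_gc y Hy) as Hh.
  replace (_ / 2) with (ssum IZR (fun s => IZR s * gc y s) t).
  - apply csum_derive; eauto using zabs_gc, zabs_mul1, zabs_mul2.
  - pose proof (ssum_conv _ _ _ _ _ _ t half_add_half (fun N => conv_hf y N Hy) (zabs_hc y Hy) (zabs_fc y Hy)) as E.
    rewrite csum_hc in E by exact Hy. unfold ssum at 3 in E.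
    rewrite (zsum_pred (fun s => IZR s * (2 * gc y s) * sin (IZR s * t))
       (zabs_sin (fun s => IZR s * (2 * gc y s)) IZR t (zabs_mul1 y _ _ Hy (admissible_scal _ _ _ 2 Hh)))) in E.
    fold (ssum IZR (fun s => IZR s * (2 * gc y s)) t) in E. rewrite ssum_double in E.
    unfold Hi, Fi. lra.
Qed.

(** * Initial values, positivity and first integrals *)

Definition F0 y := zsum (fc y).
Definition G0 y := zsum (gc y).

Lemma Fr_0 y : Fr y 0 = F0 y.
Proof. apply zsum_ext; intros. now rewrite Rmult_0_r, exp_0, Rmult_1_r. Qed.
Lemma Gr_0 y : Gr y 0 = G0 y.
Proof. apply zsum_ext; intros. now rewrite Rmult_0_r, exp_0, Rmult_1_r. Qed.
Lemma Fi_0 y : Fi y 0 = F0 y.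
Proof. apply zsum_ext; intros. now rewrite Rmult_0_r, cos_0, Rmult_1_r. Qed.
Lemma Gi_0 y : Gi y 0 = G0 y.
Proof. apply zsum_ext; intros. now rewrite Rmult_0_r, cos_0, Rmult_1_r. Qed.
Lemma Hr_0 y : 0 < y -> Hr y 0 = 0.
Proof.
  intros Hy. transitivity (csum half (hc y) 0); [|now apply csum_hc]. apply zsum_ext; intros.
  now rewrite Rmult_0_r, exp_0, cos_0.
Qed.
Lemma Hi_0 y : Hi y 0 = 0.
Proof.
  unfold Hi, ssum. rewrite (zsum_ext _ (fun s => 0 * 0)).
  - rewrite zsum_scal; ring.
  - intros; rewrite Rmult_0_r, sin_0; ring.
Qed.

Lemma zsum_pos f : zabs f -> (forall s, 0 < f s) -> 0 < zsum f.
Proof.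
  intros H Hp. pose proof (zsum_le_term f H 0) as K.
  rewrite (zsum_ext _ f) in K by (intros s; apply Rabs_pos_eq, Rlt_le, Hp).
  pose proof (Hp 0%Z). pose proof (Rle_abs (f 0%Z)). lra.
Qed.

Lemma fc_pos y s : 0 < fc y s.
Proof. apply Rinv_0_lt_compat, cosh_pos. Qed.
Lemma gc_pos y s : 0 < gc y s.
Proof. apply Rinv_0_lt_compat, cosh_pos. Qed.

Lemma Fr_pos y t : 0 < y -> Rabs t < y -> 0 < Fr y t.
Proof.
  intros Hy Ht. apply zsum_pos; [now apply admissible_fc|].
  intros s. apply Rmult_lt_0_compat; [apply fc_pos|apply exp_pos].
Qed.
Lemma Gr_pos y t : 0 < y -> Rabs t < y -> 0 < Gr y t.
Proof.
  intros Hy Ht. apply zsum_pos; [now apply admissible_gc|].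
  intros s. apply Rmult_lt_0_compat; [apply gc_pos|apply exp_pos].
Qed.
Lemma F0_pos y : 0 < y -> 0 < F0 y.
Proof. intros Hy. rewrite <- Fr_0. apply Fr_pos; rewrite ?Rabs_R0; exact Hy. Qed.
Lemma G0_pos y : 0 < y -> 0 < G0 y.
Proof. intros Hy. rewrite <- Gr_0. apply Gr_pos; rewrite ?Rabs_R0; exact Hy. Qed.

Lemma const_of_derive_0 (g : R -> R) x0 x :
  (forall z, Rmin x0 x <= z <= Rmax x0 x -> is_derive g z 0) -> g x = g x0.
Proof.
  intros H. destruct (MVT_gen g x0 x (fun _ => 0)) as [c [_ E]].
  - intros z Hz. apply H; lra.
  - intros z Hz. apply derivable_continuous_pt. exists 0. apply is_derive_Reals, H, Hz.
  - lra.
Qed.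

Lemma const_near_0 (g : R -> R) y t : Rabs t < y ->
  (forall z, Rabs z < y -> is_derive g z 0) -> g t = g 0.
Proof.
  intros Ht H. apply const_of_derive_0. intros z Hz. apply H.
  apply Rabs_def2 in Ht. unfold Rmin, Rmax in Hz. destruct (Rle_dec 0 t); apply Rabs_def1; lra.
Qed.

Lemma const_global (g : R -> R) t : (forall z, is_derive g z 0) -> g t = g 0.
Proof. intros H. apply const_of_derive_0. intros; apply H. Qed.

Lemma is_derive_eq (f : R -> R) (x l l' : R) : is_derive f x l -> l = l' -> is_derive f x l'.
Proof. intros H <-; exact H. Qed.

Lemma is_derive_mulR (f g : R -> R) (x a b : R) :
  is_derive f x a -> is_derive g x b -> is_derive (fun t => f t * g t) x (a * g x + f x * b).
Proof. intros H1 H2. apply (is_derive_mult f g x a b H1 H2). intros; apply Rmult_comm. Qed.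
Lemma is_derive_plusR (f g : R -> R) (x a b : R) :
  is_derive f x a -> is_derive g x b -> is_derive (fun t => f t + g t) x (a + b).
Proof. intros H1 H2. apply (is_derive_plus f g x a b H1 H2). Qed.
Lemma is_derive_minusR (f g : R -> R) (x a b : R) :
  is_derive f x a -> is_derive g x b -> is_derive (fun t => f t - g t) x (a - b).
Proof. intros H1 H2. apply (is_derive_minus f g x a b H1 H2). Qed.
Lemma is_derive_compR (f g : R -> R) (x a b : R) :
  is_derive f (g x) a -> is_derive g x b -> is_derive (fun t => f (g t)) x (a * b).
Proof.
  intros H1 H2. eapply is_derive_eq; [exact (is_derive_comp f g x a b H1 H2)|].
  unfold scal; simpl; unfold mult; simpl; ring.
Qed.

Ltac derive_FGH := match goal with |- is_derive ?f _ _ =>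
  match f with
  | context [Fr] => now apply Fr_derive
  | context [Gr] => now apply Gr_derive
  | context [Hr] => now apply Hr_derive
  | context [Fi] => now apply Fi_derive
  | context [Gi] => now apply Gi_derive
  | context [Hi] => now apply Hi_derive
  end end.

Lemma Fr_Hr y t : 0 < y -> Rabs t < y -> Fr y t ^ 2 = F0 y ^ 2 + Hr y t ^ 2.
Proof.
  intros Hy Ht.
  assert (E : Fr y t * Fr y t - Hr y t * Hr y t = Fr y 0 * Fr y 0 - Hr y 0 * Hr y 0).
  { apply (const_near_0 (fun t => Fr y t * Fr y t - Hr y t * Hr y t) y t Ht).
    intros z Hz. eapply is_derive_eq.
    - apply is_derive_minusR; apply is_derive_mulR; derive_FGH.
    - simpl. field. }
  rewrite Fr_0, Hr_0 in E by exact Hy. lra.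
Qed.

Lemma Gr_Hr y t : 0 < y -> Rabs t < y -> Gr y t ^ 2 = G0 y ^ 2 + Hr y t ^ 2.
Proof.
  intros Hy Ht.
  assert (E : Gr y t * Gr y t - Hr y t * Hr y t = Gr y 0 * Gr y 0 - Hr y 0 * Hr y 0).
  { apply (const_near_0 (fun t => Gr y t * Gr y t - Hr y t * Hr y t) y t Ht).
    intros z Hz. eapply is_derive_eq.
    - apply is_derive_minusR; apply is_derive_mulR; derive_FGH.
    - simpl. field. }
  rewrite Gr_0, Hr_0 in E by exact Hy. lra.
Qed.

Lemma Gi_Hi y t : 0 < y -> Gi y t ^ 2 = G0 y ^ 2 - Hi y t ^ 2.
Proof.
  intros Hy.
  assert (E : Gi y t * Gi y t + Hi y t * Hi y t = Gi y 0 * Gi y 0 + Hi y 0 * Hi y 0).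
  { apply (const_global (fun t => Gi y t * Gi y t + Hi y t * Hi y t)).
    intros z. eapply is_derive_eq.
    - apply is_derive_plusR; apply is_derive_mulR; derive_FGH.
    - simpl. field. }
  rewrite Gi_0, Hi_0 in E. lra.
Qed.

(** * The trigonometric system between 0 and 2 PI *)

Lemma cos_int_2PI n : cos (IZR n * (2 * PI)) = 1.
Proof.
  replace (IZR n * (2 * PI)) with (2 * (IZR n * PI)) by ring. rewrite cos_2a_sin.
  rewrite (sin_eq_0_1 (IZR n * PI)); [ring|now exists n].
Qed.

Lemma Fi_2PI y : Fi y (2 * PI) = - F0 y.
Proof.
  replace (- F0 y) with ((-1) * F0 y) by ring. unfold F0. rewrite <- zsum_scal.
  apply zsum_ext; intros s. unfold half.
  replace ((IZR s - / 2) * (2 * PI)) with (IZR s * (2 * PI) - PI) by field.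
  rewrite cos_minus, cos_int_2PI, cos_PI, sin_PI. ring.
Qed.

Lemma Gi_2PI y : Gi y (2 * PI) = G0 y.
Proof. apply zsum_ext; intros s. rewrite cos_int_2PI. ring. Qed.

(** A global primitive supplies the integrating factors for linear equations with coefficient
    [Hi / 2]. Integrating termwise divides by [half s], which is at least 1/2 in absolute value. *)
Lemma Hi_primitive y : 0 < y -> exists W : R -> R, forall t, is_derive W t (Hi y t / 2).
Proof.
  intros Hy. pose proof (admissible_hc y Hy) as Hh.
  pose (c := fun s => - / 2 * (/ half s * hc y s)).
  assert (E : forall s, half s * c s = - / 2 * hc y s) by (intros s; unfold c; field; apply half_neq0).
  exists (csum half c). intros t. eapply is_derive_eq.
  - apply csum_derive.
    + apply zabs_scal. apply zabs_dom with (fun s => 2 * hc y s); [|now apply zabs_scal, zabs_hc].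
      intros s. rewrite !Rabs_mult, Rabs_inv. apply Rmult_le_compat_r; [apply Rabs_pos|].
      rewrite (Rabs_pos_eq 2) by lra. replace 2 with (/ / 2) by field.
      apply Rinv_le_contravar; [lra|apply half_Rabs].
    + apply zabs_ext with (fun s => - / 2 * hc y s); [intros; now rewrite E|]. now apply zabs_scal, zabs_hc.
    + apply zabs_ext with (fun s => - / 2 * (half s * hc y s)); [intros; rewrite E; ring|].
      apply zabs_scal. now apply zabs_mul1 with y.
  - unfold Hi, ssum.
    rewrite (zsum_ext _ (fun s => - / 2 * (hc y s * sin (half s * t)))) by (intros; rewrite E; ring).
    rewrite zsum_scal. field.
Qed.

(* [Fi - Gi] and [Fi + Gi] solve linear equations [D' = Hi D / 2] and [D' = - Hi D / 2], so they keep their sign; compare the values at [0] and [2 PI]. *)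
Lemma F0_lt_G0_and_Gi_pos y : 0 < y -> F0 y < G0 y /\ forall t, 0 < Gi y t.
Proof.
  intros Hy. destruct (Hi_primitive y Hy) as [W HW].
  assert (ED : forall (c : R) t, is_derive (fun t => exp (c * W t)) t (c * Hi y t / 2 * exp (c * W t))).
  { intros c t. eapply is_derive_eq.
    - apply (is_derive_compR exp (fun t => c * W t)); [apply is_derive_exp|].
      apply (is_derive_mulR (fun _ => c)); [apply is_derive_const|apply HW].
    - unfold zero; simpl. field. }
  assert (HD : forall t, (Fi y t - Gi y t) * exp (- 1 * W t) = (Fi y 0 - Gi y 0) * exp (- 1 * W 0)).
  { intros t. apply (const_global (fun t => (Fi y t - Gi y t) * exp (- 1 * W t))). intros z.
    eapply is_derive_eq.
    - apply is_derive_mulR; [apply is_derive_minusR; derive_FGH|apply ED].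
    - simpl. field. }
  assert (HS : forall t, (Fi y t + Gi y t) * exp (1 * W t) = (Fi y 0 + Gi y 0) * exp (1 * W 0)).
  { intros t. apply (const_global (fun t => (Fi y t + Gi y t) * exp (1 * W t))). intros z.
    eapply is_derive_eq.
    - apply is_derive_mulR; [apply is_derive_plusR; derive_FGH|apply ED].
    - simpl. field. }
  pose proof (F0_pos y Hy). pose proof (G0_pos y Hy).
  rewrite Fi_0, Gi_0 in *.
  assert (L : F0 y < G0 y).
  (* At [2 PI] the difference is [- (F0 + G0) < 0], so it is negative at [0] as well. *)
  { specialize (HD (2 * PI)). rewrite Fi_2PI, Gi_2PI in HD.
    pose proof (exp_pos (- 1 * W 0)). pose proof (exp_pos (- 1 * W (2 * PI))).
    destruct (Rlt_le_dec (F0 y) (G0 y)); [assumption|exfalso]. nra. }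
  split; [exact L|]. intros t.
  specialize (HD t). specialize (HS t).
  pose proof (exp_pos (- 1 * W 0)). pose proof (exp_pos (- 1 * W t)).
  pose proof (exp_pos (1 * W 0)). pose proof (exp_pos (1 * W t)).
  assert (Fi y t - Gi y t < 0).
  { destruct (Rlt_le_dec (Fi y t - Gi y t) 0); [assumption|exfalso].
    assert (0 <= (Fi y t - Gi y t) * exp (- 1 * W t)) by (apply Rmult_le_pos; lra).
    assert (0 < (G0 y - F0 y) * exp (- 1 * W 0)) by (apply Rmult_lt_0_compat; lra). lra. }
  assert (0 < Fi y t + Gi y t).
  { assert (0 < (F0 y + G0 y) * exp (1 * W 0)) by (apply Rmult_lt_0_compat; lra).
    destruct (Rlt_le_dec 0 (Fi y t + Gi y t)); [assumption|exfalso].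
    assert (0 <= - (Fi y t + Gi y t) * exp (1 * W t)) by (apply Rmult_le_pos; lra). lra. }
  lra.
Qed.

(** * Identification of the modulus and the periods *)

Definition ellF (k x : R) : R := RInt (fun t => / sqrt (1 - k ^ 2 * (sin t) ^ 2)) 0 x.

Lemma ell_radicand_pos k t : 0 <= k < 1 -> 0 < 1 - k ^ 2 * sin t ^ 2.
Proof.
  intros Hk. pose proof (SIN_bound t). assert (sin t ^ 2 <= 1) by nra.
  assert (k ^ 2 < 1) by nra. pose proof (pow2_ge_0 (sin t)). nra.
Qed.

Lemma ell_continuous k t : 0 <= k < 1 -> continuous (fun t => / sqrt (1 - k ^ 2 * (sin t) ^ 2)) t.
Proof.
  intros Hk. pose proof (ell_radicand_pos k t Hk) as P.
  apply (ex_derive_continuous (fun t => / sqrt (1 - k ^ 2 * (sin t) ^ 2))).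
  auto_derive. repeat split.
  - apply Rlt_le_trans with (2 := Rle_refl _). simpl in *; lra.
  - apply Rgt_not_eq, sqrt_lt_R0. simpl in *; lra.
Qed.

Lemma ellF_derive k x : 0 <= k < 1 -> is_derive (ellF k) x (/ sqrt (1 - k ^ 2 * (sin x) ^ 2)).
Proof.
  intros Hk. apply (is_derive_RInt (fun t => / sqrt (1 - k ^ 2 * (sin t) ^ 2)) (ellF k) 0 x).
  - apply filter_forall. intros z. apply (RInt_correct (V := R_CompleteNormedModule)).
    apply (ex_RInt_continuous (V := R_CompleteNormedModule)). intros; now apply ell_continuous.
  - now apply ell_continuous.
Qed.

Lemma ellF_0 k : ellF k 0 = 0.
Proof. exact (RInt_point 0 _). Qed.

Lemma ellF_lt k x z : 0 <= k < 1 -> x < z -> ellF k x < ellF k z.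
Proof.
  intros Hk Hxz. destruct (MVT_gen (ellF k) x z (fun t => / sqrt (1 - k ^ 2 * (sin t) ^ 2))) as [c [_ E]].
  - intros; now apply ellF_derive.
  - intros t _. apply derivable_continuous_pt. eexists. apply is_derive_Reals, ellF_derive, Hk.
  - assert (0 < / sqrt (1 - k ^ 2 * sin c ^ 2)) by (apply Rinv_0_lt_compat, sqrt_lt_R0, ell_radicand_pos, Hk).
    nra.
Qed.

Lemma ellF_lt_inv k x z : 0 <= k < 1 -> ellF k x < ellF k z -> x < z.
Proof.
  intros Hk H. destruct (Rtotal_order x z) as [L|[->|L]]; [assumption|lra|].
  pose proof (ellF_lt k z x Hk L). lra.
Qed.

Lemma ellF_inj k x z : 0 <= k < 1 -> ellF k x = ellF k z -> x = z.
Proof.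
  intros Hk H. destruct (Rtotal_order x z) as [L|[->|L]]; [|reflexivity|];
    pose proof (ellF_lt k _ _ Hk L); lra.
Qed.

Lemma ellK_ellF k : ellK k = ellF k (PI / 2).
Proof. reflexivity. Qed.

Lemma ellK_pos k : 0 <= k < 1 -> 0 < ellK k.
Proof. intros Hk. rewrite ellK_ellF, <- (ellF_0 k). apply ellF_lt; [exact Hk|]. pose proof PI_RGT_0; lra. Qed.

Lemma ellK_lt k1 k2 : 0 <= k1 -> k1 < k2 -> k2 < 1 -> ellK k1 < ellK k2.
Proof.
  intros H0 H1 H2. pose proof PI_RGT_0. unfold ellK. apply RInt_lt.
  - lra.
  - intros; apply ell_continuous; lra.
  - intros; apply ell_continuous; lra.
  - intros x Hx. assert (0 < sin x) by (apply sin_gt_0; lra).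
    pose proof (ell_radicand_pos k1 x). pose proof (ell_radicand_pos k2 x ltac:(lra)).
    apply Rinv_lt_contravar.
    + apply Rmult_lt_0_compat; apply sqrt_lt_R0; [assumption|]. apply ell_radicand_pos; lra.
    + apply sqrt_lt_1_alt. split; [lra|].
      assert (k1 ^ 2 < k2 ^ 2) by nra. assert (0 < sin x ^ 2) by nra. nra.
Qed.

Lemma is_derive_compatan g x l : is_derive g x l -> is_derive (fun t => atan (g t)) x (l / (1 + g x ^ 2)).
Proof.
  intros H. eapply is_derive_eq; [exact (is_derive_compR atan g x _ _ (is_derive_atan (g x)) H)|].
  unfold Rsqr. field. nra.
Qed.

Lemma sin2_atan x : sin (atan x) ^ 2 = x ^ 2 / (1 + x ^ 2).
Proof.
  rewrite sin_atan. unfold Rdiv. rewrite Rpow_mult_distr, pow_inv, pow2_sqrt; unfold Rsqr; [|nra].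
  f_equal. f_equal. ring.
Qed.

Lemma cos2_atan x : cos (atan x) ^ 2 = 1 / (1 + x ^ 2).
Proof.
  rewrite cos_atan. unfold Rdiv. rewrite Rpow_mult_distr, pow_inv, pow2_sqrt; unfold Rsqr; [|nra].
  rewrite pow1. f_equal. f_equal. ring.
Qed.

(** * The modulus attached to [y] and its two complete integrals *)

Definition kpy y := F0 y / G0 y.
Definition ky y := sqrt (1 - kpy y ^ 2).

Lemma kpy_bounds y : 0 < y -> 0 < kpy y < 1.
Proof.
  intros Hy. pose proof (F0_pos y Hy). pose proof (G0_pos y Hy).
  destruct (F0_lt_G0_and_Gi_pos y Hy) as [L _]. unfold kpy. split.
  - now apply Rdiv_lt_0_compat.
  - apply Rmult_lt_reg_r with (G0 y); [assumption|]. unfold Rdiv. rewrite Rmult_assoc, Rinv_l; lra.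
Qed.

Lemma sqrt_compl_bounds k : 0 < k < 1 -> 0 < sqrt (1 - k ^ 2) < 1.
Proof.
  intros H. split; [apply sqrt_lt_R0; nra|]. rewrite <- sqrt_1 at 2. apply sqrt_lt_1_alt. nra.
Qed.

Lemma ky_sq y : 0 < y -> ky y ^ 2 = 1 - F0 y ^ 2 / G0 y ^ 2.
Proof.
  intros Hy. pose proof (kpy_bounds y Hy). unfold ky. rewrite pow2_sqrt by nra.
  unfold kpy. pose proof (G0_pos y Hy). field. lra.
Qed.

(* Fourier series of the Jacobi amplitude. *)
Lemma amplitude y : 0 < y -> exists phi : R -> R,
  phi 0 = 0 /\ phi PI = PI / 2 /\ forall t, is_derive phi t (Gi y t / 2).
Proof.
  intros Hy. pose proof (admissible_gc y Hy) as Hg.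
  (* These coefficients integrate [gc y n * cos (n t) / 2] for [n <> 0]; the mode [0], where [gc] is
     1, integrates to the separate term [t / 2], and [dl] removes it from the sums. *)
  pose (c := fun n : Z => if Z.eqb n 0 then 0 else / 2 * (/ IZR n * gc y n)).
  pose (dl := fun n : Z => if Z.eqb n 0 then 1 else 0).
  assert (E : forall n, IZR n * c n = / 2 * (gc y n - dl n)).
  { intros n. unfold c, dl. destruct (Z.eqb_spec n 0) as [->|Hn].
    - unfold gc. rewrite !Rmult_0_l, cosh_0. lra.
    - field. now apply not_0_IZR. }
  assert (Dsum : is_zsum dl 1).
  { unfold is_zsum. apply (is_lim_seq_ext (fun _ => 1) _ 1); [|apply is_lim_seq_const].
    intros n. assert (P : sum_n (zs dl) n = (1 : R)); [|symmetry; exact P].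
    induction n.
    - rewrite sum_O. unfold zs, dl; simpl. ring.
    - rewrite sum_Sn, IHn. unfold zs, dl.
      destruct (Z.eqb_spec (Z.of_nat (S n)) 0); [lia|].
      destruct (Z.eqb_spec (- Z.of_nat (S n) - 1) 0); [lia|]. unfold plus; simpl. ring. }
  assert (Dabs : zabs dl).
  { apply zabs_le with dl.
    - intros s. unfold dl. destruct (Z.eqb s 0); rewrite Rabs_pos_eq; lra.
    - eexists; exact Dsum. }
  assert (Z1 : zabs (fun n => IZR n * c n)).
  { apply zabs_ext with (fun n => / 2 * (gc y n - dl n)); [intros; now rewrite E|].
    apply zabs_scal, zabs_minus; auto using zabs_gc. }
  assert (Z0 : zabs c).
  { apply zabs_dom with (2 := Z1). intros n. unfold c. destruct (Z.eqb_spec n 0) as [->|Hn].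
    - rewrite Rabs_R0. apply Rabs_pos.
    - rewrite (Rabs_mult (IZR n)). set (q := Rabs (_ * _)). assert (0 <= q) by apply Rabs_pos.
      assert (1 <= Rabs (IZR n)) by (rewrite <- abs_IZR; apply IZR_le; lia). nra. }
  assert (Z2 : zabs (fun n => IZR n * (IZR n * c n))).
  { apply zabs_ext with (fun n => / 2 * (IZR n * gc y n)).
    - intros n. rewrite E. unfold dl. destruct (Z.eqb_spec n 0) as [->|]; field.
    - apply zabs_scal. now apply zabs_mul1 with y. }
  exists (fun t => t / 2 + ssum IZR c t). split; [|split].
  - unfold ssum. rewrite (zsum_ext _ (fun _ => 0 * 0)), zsum_scal by (intros; rewrite Rmult_0_r, sin_0; ring). field.
  - unfold ssum. rewrite (zsum_ext _ (fun _ => 0 * 0)), zsum_scal; [field|].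
    intros s. rewrite (sin_eq_0_1 (IZR s * PI)); [ring|now exists s].
  - intros t. eapply is_derive_eq.
    + apply (is_derive_plusR (fun t => t / 2)); [|now apply ssum_derive].
      apply (is_derive_mulR (fun t => t) (fun _ => / 2)); [apply is_derive_id|apply is_derive_const].
    + unfold csum. rewrite (zsum_ext _ (fun n => / 2 * (gc y n * cos (IZR n * t) - dl n))).
      * rewrite zsum_scal, zsum_minus, (is_zsum_unique _ _ Dsum); auto using zabs_cos, zabs_gc.
        unfold one, zero; simpl. unfold Gi, csum. field.
      * intros n. rewrite E. unfold dl. destruct (Z.eqb_spec n 0) as [->|]; [|ring].
        rewrite Rmult_0_l, cos_0. ring.
Qed.

(** Along the amplitude [phi] one has [Hi = F0 sin phi] and [Gi = G0 sqrt (1 - kpy^2 sin^2 phi)].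
    The incomplete integral up to [phi t] therefore grows at the constant speed [G0 / 2], and [phi]
    reaches [PI / 2] at [t = PI]. *)
Lemma ellK_imag y : 0 < y -> ellK (kpy y) = PI * G0 y / 2.
Proof.
  intros Hy. destruct (amplitude y Hy) as [phi [P0 [P1 HP]]].
  pose proof (kpy_bounds y Hy) as Hk. destruct (F0_lt_G0_and_Gi_pos y Hy) as [_ Gp].
  pose proof (G0_pos y Hy) as HG. pose proof (F0_pos y Hy) as HF.
  assert (Dc : forall t, is_derive (fun t => cos (phi t)) t (- sin (phi t) * (Gi y t / 2))).
  { intros t. exact (is_derive_compR cos phi t _ _ (is_derive_cos (phi t)) (HP t)). }
  assert (Ds : forall t, is_derive (fun t => sin (phi t)) t (cos (phi t) * (Gi y t / 2))).
  { intros t. exact (is_derive_compR sin phi t _ _ (is_derive_sin (phi t)) (HP t)). }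
  (* The vector [(Fi, Hi)] turns with angular speed [Gi / 2], the derivative of [phi]; turned back
     by [phi] it stays at its initial value [(F0, 0)]. *)
  assert (C1 : forall t, Fi y t * cos (phi t) + Hi y t * sin (phi t) = F0 y).
  { intros t. transitivity (Fi y 0 * cos (phi 0) + Hi y 0 * sin (phi 0)).
    - apply (const_global (fun t => Fi y t * cos (phi t) + Hi y t * sin (phi t))). intros z.
      eapply is_derive_eq.
      + apply is_derive_plusR; apply is_derive_mulR; match goal with
        | |- is_derive (fun t => cos (phi t)) _ _ => apply Dc
        | |- is_derive (fun t => sin (phi t)) _ _ => apply Ds
        | _ => derive_FGH end.
      + simpl. field.
    - rewrite P0, Fi_0, cos_0, sin_0. ring. }
  assert (C2 : forall t, Hi y t * cos (phi t) - Fi y t * sin (phi t) = 0).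
  { intros t. transitivity (Hi y 0 * cos (phi 0) - Fi y 0 * sin (phi 0)).
    - apply (const_global (fun t => Hi y t * cos (phi t) - Fi y t * sin (phi t))). intros z.
      eapply is_derive_eq.
      + apply is_derive_minusR; apply is_derive_mulR; match goal with
        | |- is_derive (fun t => cos (phi t)) _ _ => apply Dc
        | |- is_derive (fun t => sin (phi t)) _ _ => apply Ds
        | _ => derive_FGH end.
      + simpl. field.
    - rewrite P0, Hi_0, sin_0. ring. }
  assert (HH : forall t, Hi y t = F0 y * sin (phi t)).
  { intros t. specialize (C1 t). specialize (C2 t).
    pose proof (sin2_cos2 (phi t)) as S. unfold Rsqr in S.
    assert (Hi y t * (sin (phi t) * sin (phi t) + cos (phi t) * cos (phi t)) = F0 y * sin (phi t)).
    { rewrite <- C1. replace (Hi y t * (sin (phi t) * sin (phi t) + cos (phi t) * cos (phi t)))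
        with (Hi y t * sin (phi t) * sin (phi t) + (Hi y t * cos (phi t) - Fi y t * sin (phi t)) * cos (phi t)
              + Fi y t * sin (phi t) * cos (phi t)) by ring. rewrite C2. ring. }
    rewrite S in H. lra. }
  assert (HR : forall t, sqrt (1 - kpy y ^ 2 * sin (phi t) ^ 2) = Gi y t / G0 y).
  { intros t. replace (1 - kpy y ^ 2 * sin (phi t) ^ 2) with ((Gi y t / G0 y) ^ 2).
    - apply sqrt_pow2. left. apply Rdiv_lt_0_compat; auto.
    - unfold Rdiv. rewrite Rpow_mult_distr, Gi_Hi, HH by exact Hy. unfold kpy. field. lra. }
  assert (D : ellF (kpy y) (phi PI) - PI * G0 y / 2 = ellF (kpy y) (phi 0) - 0 * G0 y / 2).
  { apply (const_global (fun t => ellF (kpy y) (phi t) - t * G0 y / 2)). intros z.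
    eapply is_derive_eq.
    - apply is_derive_minusR.
      + apply is_derive_compR; [apply ellF_derive; lra|apply HP].
      + apply (is_derive_mulR (fun t => t * G0 y) (fun _ => / 2)); [|apply is_derive_const].
        apply (is_derive_mulR (fun t => t) (fun _ => G0 y)); [apply is_derive_id|apply is_derive_const].
    - cbv beta. rewrite HR. unfold one, zero; simpl. specialize (Gp z). field. lra. }
  rewrite P0, P1, ellF_0, <- ellK_ellF in D. lra.
Qed.

(** The angle with tangent [Hr / F0] is the amplitude, as sc is its tangent. By the first integrals
    the angle has derivative [Gr * F0 / (2 * Fr)] and the integrand is [Fr * G0 / (Gr * F0)]; their
    product is constant. *)
Lemma ellF_amplitude1 y t : 0 < y -> Rabs t < y ->
  is_derive (fun t => ellF (ky y) (atan (Hr y t / F0 y))) t (G0 y / 2).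
Proof.
  intros Hy Ht. pose proof (kpy_bounds y Hy) as Hk. pose proof (sqrt_compl_bounds _ Hk) as Hk'.
  pose proof (G0_pos y Hy) as HG. pose proof (F0_pos y Hy) as HF.
  pose proof (Fr_pos y t Hy Ht) as PF. pose proof (Gr_pos y t Hy Ht) as PG.
  pose proof (Fr_Hr y t Hy Ht) as EF. pose proof (Gr_Hr y t Hy Ht) as EG.
  eapply is_derive_eq.
  - apply is_derive_compR; [apply ellF_derive; fold (ky y) in Hk'; lra|].
    apply is_derive_compatan.
    apply (is_derive_mulR (Hr y) (fun _ => / F0 y)); [now apply Hr_derive|apply is_derive_const].
  - rewrite sin2_atan, ky_sq by exact Hy.
    replace (1 - _) with ((Gr y t * F0 y / (Fr y t * G0 y)) ^ 2).
    + rewrite sqrt_pow2.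
      * unfold zero; simpl. replace (1 + Hr y t / F0 y * (Hr y t / F0 y * 1)) with (Fr y t ^ 2 / F0 y ^ 2).
        -- field. repeat split; lra.
        -- rewrite EF. field. lra.
      * left. apply Rdiv_lt_0_compat; apply Rmult_lt_0_compat; assumption.
    + replace (1 + (Hr y t / F0 y) ^ 2) with (Fr y t ^ 2 / F0 y ^ 2) by (rewrite EF; field; lra).
      replace ((Hr y t / F0 y) ^ 2) with ((Fr y t ^ 2 - F0 y ^ 2) / F0 y ^ 2) by (rewrite EF; field; lra).
      replace ((Gr y t * F0 y / (Fr y t * G0 y)) ^ 2) with ((G0 y ^ 2 + (Fr y t ^ 2 - F0 y ^ 2)) * F0 y ^ 2 / (Fr y t ^ 2 * G0 y ^ 2)).
      * field. lra.
      * replace (G0 y ^ 2 + (Fr y t ^ 2 - F0 y ^ 2)) with (Gr y t ^ 2) by lra. field. lra.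
Qed.

(* The complementary amplitude: [sc (K - t) = 1 / (k' sc t)]. *)
Lemma ellF_amplitude2 y t : 0 < y -> Rabs t < y ->
  is_derive (fun t => ellF (ky y) (PI / 2 - atan (Hr y t / G0 y))) t (- (G0 y / 2)).
Proof.
  intros Hy Ht. pose proof (kpy_bounds y Hy) as Hk. pose proof (sqrt_compl_bounds _ Hk) as Hk'.
  pose proof (G0_pos y Hy) as HG. pose proof (F0_pos y Hy) as HF.
  pose proof (Fr_pos y t Hy Ht) as PF. pose proof (Gr_pos y t Hy Ht) as PG.
  pose proof (Fr_Hr y t Hy Ht) as EF. pose proof (Gr_Hr y t Hy Ht) as EG.
  eapply is_derive_eq.
  - apply is_derive_compR; [apply ellF_derive; fold (ky y) in Hk'; lra|].
    apply (is_derive_minusR (fun _ => PI / 2)); [apply is_derive_const|].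
    apply is_derive_compatan.
    apply (is_derive_mulR (Hr y) (fun _ => / G0 y)); [now apply Hr_derive|apply is_derive_const].
  - rewrite sin_shift, cos2_atan, ky_sq by exact Hy.
    replace (1 - _) with ((Fr y t / Gr y t) ^ 2).
    + rewrite sqrt_pow2.
      * unfold zero; simpl. replace (1 + Hr y t / G0 y * (Hr y t / G0 y * 1)) with (Gr y t ^ 2 / G0 y ^ 2).
        -- field. repeat split; lra.
        -- rewrite EG. field. lra.
      * left. apply Rdiv_lt_0_compat; assumption.
    + replace (1 + (Hr y t / G0 y) ^ 2) with (Gr y t ^ 2 / G0 y ^ 2) by (rewrite EG; field; lra).
      replace ((Fr y t / Gr y t) ^ 2) with ((Gr y t ^ 2 - G0 y ^ 2 + F0 y ^ 2) / Gr y t ^ 2).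
      * field. lra.
      * replace (Gr y t ^ 2 - G0 y ^ 2 + F0 y ^ 2) with (Fr y t ^ 2) by lra. field. lra.
Qed.

Lemma is_derive_linear c t : is_derive (fun t => t * c) t c.
Proof.
  eapply is_derive_eq.
  - apply (is_derive_mulR (fun t => t) (fun _ => c)); [apply is_derive_id|apply is_derive_const].
  - unfold one, zero; simpl; ring.
Qed.

Lemma ellF_real y t : 0 < y -> Rabs t < y -> ellF (ky y) (atan (Hr y t / F0 y)) = t * (G0 y / 2).
Proof.
  intros Hy Ht.
  assert (E : ellF (ky y) (atan (Hr y t / F0 y)) - t * (G0 y / 2) =
              ellF (ky y) (atan (Hr y 0 / F0 y)) - 0 * (G0 y / 2)).
  { apply (const_near_0 (fun t => ellF (ky y) (atan (Hr y t / F0 y)) - t * (G0 y / 2)) y t Ht).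
    intros z Hz. eapply is_derive_eq.
    - apply is_derive_minusR; [now apply ellF_amplitude1|apply is_derive_linear].
    - simpl; ring. }
  rewrite Hr_0 in E by exact Hy. unfold Rdiv in E at 3.
  rewrite Rmult_0_l, atan_0, ellF_0 in E. lra.
Qed.

Lemma ellF_real_compl y t : 0 < y -> Rabs t < y ->
  ellF (ky y) (PI / 2 - atan (Hr y t / G0 y)) = ellK (ky y) - t * (G0 y / 2).
Proof.
  intros Hy Ht.
  assert (E : ellF (ky y) (PI / 2 - atan (Hr y t / G0 y)) + t * (G0 y / 2) =
              ellF (ky y) (PI / 2 - atan (Hr y 0 / G0 y)) + 0 * (G0 y / 2)).
  { apply (const_near_0 (fun t => ellF (ky y) (PI / 2 - atan (Hr y t / G0 y)) + t * (G0 y / 2)) y t Ht).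
    intros z Hz. eapply is_derive_eq.
    - apply is_derive_plusR; [now apply ellF_amplitude2|apply is_derive_linear].
    - simpl; ring. }
  rewrite Hr_0 in E by exact Hy. unfold Rdiv in E at 5.
  rewrite Rmult_0_l, atan_0, Rminus_0_r, <- ellK_ellF in E. lra.
Qed.

(** Within distance [1 / (n + 1)] of [y] the terms [s = 1, ..., n] have [half s * (y - t) <= 1], and
    [cosh x <= exp x] makes each at least [exp (-1)]. The maximum with 0 serves the case
    [y < 1 / (n + 1)]. *)
Lemma Fr_unbounded y n : 0 < y -> exists t, 0 <= t < y /\ INR n * exp (-1) <= Fr y t.
Proof.
  intros Hy. pose proof (pos_INR n) as Hn.
  assert (Hi : 0 < / (INR n + 1)) by (apply Rinv_0_lt_compat; lra).
  pose (t := Rmax 0 (y - / (INR n + 1))).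
  assert (Ht : 0 <= t < y) by (unfold t; split; [apply Rmax_l|apply Rmax_lub_lt; lra]).
  assert (Ht2 : y - t <= / (INR n + 1)) by (unfold t; pose proof (Rmax_r 0 (y - / (INR n + 1))); lra).
  exists t. split; [exact Ht|].
  pose proof (admissible_fc y Hy t ltac:(rewrite Rabs_pos_eq; lra)) as Z.
  assert (Pz : forall s, 0 < fc y s * exp (half s * t)).
  { intros; apply Rmult_lt_0_compat; [apply fc_pos|apply exp_pos]. }
  assert (S : sum_n (zs (fun s => fc y s * exp (half s * t))) n <= Fr y t).
  { apply series_partial_le; [|now apply zabs_correct].
    intros k. apply Rplus_le_le_0_compat; apply Rlt_le, Pz. }
  apply Rle_trans with (2 := S).
  assert (T : forall s, (1 <= s <= Z.of_nat n)%Z -> exp (-1) <= fc y s * exp (half s * t)).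
  { intros s Hs. assert (H1 : 1 <= IZR s) by (apply IZR_le; lia).
    assert (H2 : IZR s <= INR n) by (rewrite INR_IZR_INZ; apply IZR_le; lia).
    assert (Hh : 0 < half s <= INR n) by (unfold half; lra).
    assert (C : cosh (half s * y) <= exp (half s * y)).
    { unfold cosh. assert (exp (- (half s * y)) < exp (half s * y)) by (apply exp_increasing; nra). lra. }
    apply Rle_trans with (exp (- (half s * y)) * exp (half s * t)).
    - rewrite <- exp_plus.
      assert (L : half s * (y - t) <= 1).
      { apply Rle_trans with (INR n * / (INR n + 1)).
        - apply Rmult_le_compat; lra.
        - apply Rmult_le_reg_r with (INR n + 1); [lra|]. rewrite Rmult_assoc, Rinv_l; lra. }
      destruct (Req_dec (-1) (- (half s * y) + half s * t)) as [<-|]; [lra|].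
      left; apply exp_increasing; lra.
    - apply Rmult_le_compat_r; [left; apply exp_pos|].
      rewrite exp_Ropp. unfold fc. apply Rinv_le_contravar; [apply cosh_pos|exact C]. }
  assert (Q : forall m, (m <= n)%nat -> INR m * exp (-1) <= sum_n (zs (fun s => fc y s * exp (half s * t))) m).
  { induction m; intros Hm.
    - rewrite sum_O. simpl. unfold zs. rewrite Rmult_0_l. left. apply Rplus_lt_0_compat; apply Pz.
    - rewrite sum_Sn, S_INR.
      specialize (IHm ltac:(lia)). specialize (T (Z.of_nat (Datatypes.S m)) ltac:(lia)).
      pose proof (Pz (- Z.of_nat (Datatypes.S m) - 1)%Z).
      rewrite Rmult_plus_distr_r, Rmult_1_l. apply Rplus_le_compat; [exact IHm|]. unfold zs. lra. }
  apply Q; lia.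
Qed.

(** The amplitude stays below [PI / 2] on the whole interval, so [t * G0 / 2] never exceeds the
    complete integral. If the latter were larger than [y * G0 / 2], the amplitude would stay below
    some [x < PI / 2], and [Fr] would be bounded up to [y]. *)
Lemma ellK_real y : 0 < y -> ellK (ky y) = y * (G0 y / 2).
Proof.
  intros Hy. pose proof (kpy_bounds y Hy) as Hk.
  assert (Hk' : 0 <= ky y < 1) by (pose proof (sqrt_compl_bounds _ Hk); unfold ky; lra).
  pose proof (G0_pos y Hy) as HG. pose proof (F0_pos y Hy) as HF. pose proof PI_RGT_0.
  assert (U : forall t, Rabs t < y -> t * (G0 y / 2) <= ellK (ky y)).
  { intros t Ht. rewrite <- ellF_real by assumption. left. apply ellF_lt; [exact Hk'|apply atan_bound]. }
  pose proof (ellK_pos (ky y) Hk').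
  destruct (Rtotal_order (ellK (ky y)) (y * (G0 y / 2))) as [L|[E|L]]; [exfalso|exact E|exfalso].
  - set (t := ellK (ky y) / (G0 y / 2)).
    assert (Et : t * (G0 y / 2) = ellK (ky y)) by (unfold t; field; lra).
    assert (0 < t) by (unfold t; apply Rdiv_lt_0_compat; lra).
    assert (t < y) by (apply Rmult_lt_reg_r with (G0 y / 2); lra).
    specialize (U ((t + y) / 2) ltac:(rewrite Rabs_pos_eq; lra)). nra.
  - assert (Cn : continuity_pt (ellF (ky y)) (PI / 2)).
    { apply derivable_continuous_pt. eexists. apply is_derive_Reals, ellF_derive, Hk'. }
    destruct (Cn (ellK (ky y) - y * (G0 y / 2)) ltac:(lra)) as [d [Hd D]].
    (* Halving keeps [x] strictly inside the continuity window; the cap at 1 keeps it positive, as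
       [PI / 2 > 1]. *)
    set (x := PI / 2 - Rmin d 1 / 2).
    assert (Hm : 0 < Rmin d 1 <= 1) by (split; [apply Rmin_glb_lt; lra|apply Rmin_r]).
    assert (Hm2 : Rmin d 1 <= d) by apply Rmin_l.
    pose proof PI2_1.
    assert (Hx : 0 < x < PI / 2) by (unfold x; lra).
    assert (Ex : y * (G0 y / 2) < ellF (ky y) x).
    { specialize (D x). simpl in D. unfold R_dist in D.
      assert (Rabs (ellF (ky y) x - ellF (ky y) (PI / 2)) < ellK (ky y) - y * (G0 y / 2)).
      { apply D. split; [split; [exact I|lra]|]. unfold x.
        replace (PI / 2 - Rmin d 1 / 2 - PI / 2) with (- (Rmin d 1 / 2)) by ring.
        rewrite Rabs_Ropp, Rabs_pos_eq; lra. }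
      rewrite <- ellK_ellF in *. apply Rabs_def2 in H2. lra. }
    (* This is [nc <= 1 + sc], with sc the tangent of an amplitude below [x]. *)
    assert (B : forall t, 0 <= t < y -> Fr y t <= F0 y * (1 + tan x)).
    { intros t Ht. assert (Ht' : Rabs t < y) by (rewrite Rabs_pos_eq; lra).
      pose proof (ellF_real y t Hy Ht') as E.
      assert (A1 : atan (Hr y t / F0 y) < x).
      { apply (ellF_lt_inv (ky y)); [exact Hk'|]. rewrite E. nra. }
      assert (A0 : 0 <= atan (Hr y t / F0 y)).
      { destruct (Rlt_le_dec (atan (Hr y t / F0 y)) 0) as [N|]; [|assumption].
        apply (ellF_lt (ky y)) in N; [|exact Hk']. rewrite E, ellF_0 in N. nra. }
      assert (T1 : Hr y t / F0 y < tan x).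
      { rewrite <- (tan_atan (Hr y t / F0 y)). apply tan_increasing; lra. }
      assert (T0 : 0 <= Hr y t / F0 y).
      { rewrite <- (tan_atan (Hr y t / F0 y)). destruct A0 as [A0| <-]; [|rewrite tan_0; lra].
        left. rewrite <- tan_0. apply tan_increasing; lra. }
      pose proof (Fr_Hr y t Hy Ht') as EF. pose proof (Fr_pos y t Hy Ht').
      replace (Hr y t) with (F0 y * (Hr y t / F0 y)) in EF by (field; lra).
      set (q := Hr y t / F0 y) in *.
      apply Rle_trans with (F0 y * (1 + q)); [|nra].
      apply Rsqr_incr_0_var; [unfold Rsqr; nra|nra]. }
    set (M := F0 y * (1 + tan x)) in *.
    destruct (INR_unbounded (M / exp (-1))) as [n Hn].
    destruct (Fr_unbounded y n Hy) as [t [Ht Hb]]. specialize (B t Ht).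
    pose proof (exp_pos (-1)). apply (Rmult_lt_compat_r (exp (-1))) in Hn; [|assumption].
    unfold Rdiv in Hn. rewrite Rmult_assoc, Rinv_l in Hn by lra. lra.
Qed.

(** At [t = y / 2] the incomplete integrals of the amplitude and of its complement are both half of
    the complete one. The two angles thus coincide, and their tangents [H / F0] and [G0 / H] are
    equal. *)
Lemma Hr_half y : 0 < y -> Hr y (y / 2) ^ 2 = F0 y * G0 y /\ 0 < Hr y (y / 2).
Proof.
  intros Hy. pose proof (kpy_bounds y Hy) as Hk.
  assert (Hk' : 0 <= ky y < 1) by (pose proof (sqrt_compl_bounds _ Hk); unfold ky; lra).
  pose proof (G0_pos y Hy) as HG. pose proof (F0_pos y Hy) as HF.
  assert (Ht : Rabs (y / 2) < y) by (rewrite Rabs_pos_eq; lra).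
  pose proof (ellF_real y _ Hy Ht) as E1. pose proof (ellF_real_compl y _ Hy Ht) as E2.
  rewrite ellK_real in E2 by exact Hy.
  assert (E : atan (Hr y (y / 2) / F0 y) = PI / 2 - atan (Hr y (y / 2) / G0 y)).
  { apply (ellF_inj (ky y)); [exact Hk'|]. rewrite E1, E2. field. }
  assert (P : 0 < atan (Hr y (y / 2) / F0 y)).
  { apply (ellF_lt_inv (ky y)); [exact Hk'|]. rewrite E1, ellF_0. nra. }
  set (H := Hr y (y / 2)) in *.
  assert (P1 : 0 < H).
  { pose proof (atan_bound (H / F0 y)).
    assert (T : tan 0 < tan (atan (H / F0 y))) by (apply tan_increasing; lra).
    rewrite tan_0, tan_atan in T. apply (Rmult_lt_compat_r (F0 y)) in T; [|exact HF].
    unfold Rdiv in T. rewrite Rmult_assoc, Rinv_l in T; lra. }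
  split; [|exact P1].
  assert (Q : H / F0 y = / (H / G0 y)).
  { rewrite <- (tan_atan (H / F0 y)), E, <- atan_inv, tan_atan; [reflexivity|].
    now apply Rdiv_lt_0_compat. }
  replace (H ^ 2) with (H / F0 y * H * F0 y) by (field; lra). rewrite Q. field. lra.
Qed.

(* The ratio of the two complete integrals is monotone in the modulus, so it determines the modulus. *)
Lemma identify kp : 0 < kp < 1 ->
  let y := PI * ellK (sqrt (1 - kp ^ 2)) / ellK kp in
  0 < y /\ kpy y = kp /\ ellK kp = PI * G0 y / 2.
Proof.
  intros Hkp y. pose proof PI_RGT_0 as HPI.
  pose proof (sqrt_compl_bounds kp Hkp) as Hk.
  pose proof (ellK_pos kp ltac:(lra)) as K1. pose proof (ellK_pos (sqrt (1 - kp ^ 2)) ltac:(lra)) as K2.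
  assert (Hy : 0 < y) by (unfold y; apply Rdiv_lt_0_compat; nra).
  pose proof (kpy_bounds y Hy) as Hl. pose proof (sqrt_compl_bounds _ Hl) as Hl'. fold (ky y) in Hl'.
  pose proof (ellK_imag y Hy) as E1. pose proof (ellK_real y Hy) as E2.
  pose proof (G0_pos y Hy) as HG.
  (* For [kpy y] and for [kp] alike, the integral of the complementary modulus divided by that of
     the modulus is [y / PI]; this is the cross product. *)
  assert (R : ellK (ky y) * ellK kp = ellK (sqrt (1 - kp ^ 2)) * ellK (kpy y)).
  { rewrite E1, E2. unfold y at 1. field. lra. }
  pose proof (ellK_pos (kpy y) ltac:(lra)) as K3. pose proof (ellK_pos (ky y) ltac:(lra)) as K4.
  assert (E : kpy y = kp).
  { destruct (Rtotal_order (kpy y) kp) as [L|[E|L]]; [exfalso|exact E|exfalso].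
    - pose proof (ellK_lt (kpy y) kp ltac:(lra) L ltac:(lra)).
      assert (ellK (sqrt (1 - kp ^ 2)) < ellK (ky y)).
      { apply ellK_lt; try lra. unfold ky. apply sqrt_lt_1_alt. nra. }
      nra.
    - pose proof (ellK_lt kp (kpy y) ltac:(lra) L ltac:(lra)).
      assert (ellK (ky y) < ellK (sqrt (1 - kp ^ 2))).
      { apply ellK_lt; try lra. unfold ky. apply sqrt_lt_1_alt. nra. }
      nra. }
  repeat split; [exact Hy|exact E|]. rewrite <- E. exact E1.
Qed.

(** * Orthogonality *)

(** The third hypothesis says that multiplication by [x] is symmetric for the form [A]; it expresses
    column [m + 1] through earlier columns, so column 0 determines everything. The induction treats
    only [q <= n], and symmetry gives the rest. *)
Lemma favard (A : nat -> nat -> R) (be mu hh : nat -> R) :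
  (forall n m, A n m = A m n) -> mu 0%nat = 0 ->
  (forall n m, A (S n) m + be n * A n m + mu n * A (pred n) m =
               A n (S m) + be m * A n m + mu m * A n (pred m)) ->
  (forall n, A n 0%nat = if Nat.eqb n 0 then hh 0%nat else 0) ->
  (forall m, hh (S m) = hh m * mu (S m)) ->
  forall n m, A n m = if Nat.eqb n m then hh n else 0.
Proof.
  intros Hs H0 Hr Hi Hh.
  assert (K : forall m q n, (q <= m)%nat -> (q <= n)%nat -> A n q = if Nat.eqb n q then hh n else 0).
  { induction m as [|m IH]; intros q n Hq Hn.
    - replace q with 0%nat by lia. rewrite Hi. destruct (Nat.eqb_spec n 0) as [->|]; reflexivity.
    - destruct (Nat.eq_dec q (S m)) as [->|]; [|apply IH; lia].
      specialize (Hr n m). destruct n as [|n]; [lia|]. cbn [pred] in Hr.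
      rewrite (IH m (S (S n))), (IH m (S n)), (IH m n) in Hr by lia.
      (* For [m = 0] the convention [pred 0 = 0] does no harm because [mu 0 = 0]. *)
      assert (Z : mu m * A (S n) (pred m) = 0).
      { destruct m as [|m]; [rewrite H0; ring|]. rewrite IH by (simpl; lia).
        destruct (Nat.eqb_spec (S n) (pred (S m))); [simpl in *; lia|ring]. }
      rewrite Z in Hr.
      destruct (Nat.eqb_spec (S (S n)) m); [lia|]. destruct (Nat.eqb_spec (S n) m); [lia|].
      change (Nat.eqb (S n) (S m)) with (Nat.eqb n m).
      destruct (Nat.eqb_spec n m) as [e|e].
      + rewrite <- e in *. rewrite Hh. lra.
      + lra. }
  intros n m. destruct (le_lt_dec m n).
  - apply (K m m n); lia.
  - rewrite Hs, (K n n m) by lia. rewrite Nat.eqb_sym. destruct (Nat.eqb_spec n m) as [->|]; reflexivity.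
Qed.

(** * The polynomials applied to nc in closed form *)

Lemma P_succ kp n x : P kp (S n) x = (x - b kp n) * P kp n x - u kp n * P kp (pred n) x.
Proof.
  destruct n as [|n].
  (* At index 0 the last term has the factor [u kp 0 = 0]. *)
  - unfold P; simpl. unfold u; simpl. ring.
  - unfold P. simpl. destruct (Ppair kp x n) as [p q]. reflexivity.
Qed.

(* [vr] is [u n / n^2]; [E r] and [Q] satisfy [P_n(d/dt) nc = c_n Q^(n/4) E (n mod 4)], where [w = nc], [z = nc']. *)
Definition vr (k : R) (r : nat) : R :=
  match r with 0%nat => k * (k + 1) | 2%nat => 1 + k | _ => 2 * k end.

Definition Qp (k w z : R) : R :=
  (k ^ 2 * w ^ 4 + 2 * (1 + k) * w ^ 2 - (1 + k) ^ 2 - 2 * (1 + k) * w * z) / (4 * k * (1 + k) ^ 2).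

(** These are forced: three steps of [T_(n+1) = T_n' - b_n T_n - u_n T_(n-1)] from [T_0 = w],
    divided by [cn], give them, and the fourth step gives [Qp * w] modulo the quartic relation for
    [z^2]. *)
Definition Ep (k : R) (r : nat) (w z : R) : R :=
  match r with
  | 0%nat => w
  | 1%nat => (z - w) / (2 * k)
  | 2%nat => (k ^ 2 * w ^ 3 + (1 - k ^ 2) * w - (1 + k) * z) / (2 * k * (1 + k))
  | _ => (k * w ^ 2 * z + (k + 1) * z - k * (1 + 2 * k) * w ^ 3 + (1 + k) * (2 * k - 1) * w)
         / (4 * k * (1 + k))
  end.

(** The second derivative of nc as a polynomial in nc, from differentiating
    [z^2 = (w^2 - 1) (k^2 w^2 + 1 - k^2)] along [w' = z]. [DQ] and [DE] below are derivatives along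
    the same flow. *)
Definition dz (k w : R) : R := w * (2 * k ^ 2 * w ^ 2 + 1 - 2 * k ^ 2).

Definition DQ (k w z : R) : R :=
  ((4 * k ^ 2 * w ^ 3 + 4 * (1 + k) * w - 2 * (1 + k) * z) * z - 2 * (1 + k) * w * dz k w)
  / (4 * k * (1 + k) ^ 2).

Definition DE (k : R) (r : nat) (w z : R) : R :=
  match r with
  | 0%nat => z
  | 1%nat => (dz k w - z) / (2 * k)
  | 2%nat => ((3 * k ^ 2 * w ^ 2 + (1 - k ^ 2)) * z - (1 + k) * dz k w) / (2 * k * (1 + k))
  | _ => ((2 * k * w * z - 3 * k * (1 + 2 * k) * w ^ 2 + (1 + k) * (2 * k - 1)) * z
          + (k * w ^ 2 + (k + 1)) * dz k w) / (4 * k * (1 + k))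
  end.

(** A normalising product, not the Jacobi function. It is chosen so that
    [u n * cn (n-1) = n * cn n]: after division by [cn] the recurrence has coefficients affine in
    [n] on each class mod 4. *)
Fixpoint cn (k : R) (n : nat) : R :=
  match n with
  | O => 1
  | S m => cn k m * (INR (S m) * vr k ((S m) mod 4))
  end.

Definition Tn (k : R) (n : nat) (w z : R) : R := cn k n * (Qp k w z ^ (n / 4) * Ep k (n mod 4) w z).

Lemma u_vr k n : u k n = INR n ^ 2 * vr k (n mod 4).
Proof.
  unfold u, vr. pose proof (Nat.mod_upper_bound n 4 ltac:(lia)).
  destruct (n mod 4)%nat as [|[|[|[|]]]]; try ring. 
Qed.

(** For [n = 4 j + r] the recurrence for [Qp^j * Ep r] is affine in [j]. The [DQ_E] identities
    compare the coefficients of [j], the [DE_] identities the constant terms. *)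
Lemma DQ_E0 k w z : 0 < k -> z ^ 2 = (w ^ 2 - 1) * (k ^ 2 * w ^ 2 + 1 - k ^ 2) ->
  DQ k w z * Ep k 0 w z =
  4 * (2 * k * Qp k w z * Ep k 1 w z + (k + 3) / 2 * Qp k w z * Ep k 0 w z + Ep k 3 w z).
Proof. intros Hk Hz. unfold DQ, Qp, Ep, dz. field [Hz]; lra. Qed.

Lemma DQ_E1 k w z : 0 < k -> z ^ 2 = (w ^ 2 - 1) * (k ^ 2 * w ^ 2 + 1 - k ^ 2) ->
  DQ k w z * Ep k 1 w z =
  4 * Qp k w z * ((1 + k) * Ep k 2 w z + (3 * k + 1) / 2 * Ep k 1 w z + Ep k 0 w z).
Proof. intros Hk Hz. unfold DQ, Qp, Ep, dz. field [Hz]; lra. Qed.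

Lemma DQ_E2 k w z : 0 < k -> z ^ 2 = (w ^ 2 - 1) * (k ^ 2 * w ^ 2 + 1 - k ^ 2) ->
  DQ k w z * Ep k 2 w z =
  4 * Qp k w z * (2 * k * Ep k 3 w z + (3 * k + 1) / 2 * Ep k 2 w z + Ep k 1 w z).
Proof. intros Hk Hz. unfold DQ, Qp, Ep, dz. field [Hz]; lra. Qed.

Lemma DQ_E3 k w z : 0 < k -> z ^ 2 = (w ^ 2 - 1) * (k ^ 2 * w ^ 2 + 1 - k ^ 2) ->
  DQ k w z * Ep k 3 w z =
  4 * Qp k w z * (k * (k + 1) * (Qp k w z * Ep k 0 w z) + (k + 3) / 2 * Ep k 3 w z + Ep k 2 w z).
Proof. intros Hk Hz. unfold DQ, Qp, Ep, dz. field [Hz]; lra. Qed.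

Lemma DE_0 k w z : 0 < k ->
  DE k 0 w z = 2 * k * Ep k 1 w z + Ep k 0 w z.
Proof. intros Hk. unfold DE, Ep. field; lra. Qed.

Lemma DE_1 k w z : 0 < k ->
  DE k 1 w z = 2 * (1 + k) * Ep k 2 w z + (2 * k + 1) * Ep k 1 w z + Ep k 0 w z.
Proof. intros Hk. unfold DE, Ep, dz. field; lra. Qed.

Lemma DE_2 k w z : 0 < k ->
  DE k 2 w z = 3 * (2 * k) * Ep k 3 w z + (4 * k + 1) * Ep k 2 w z + 2 * Ep k 1 w z.
Proof. intros Hk. unfold DE, Ep, dz. field; lra. Qed.

Lemma DE_3 k w z : 0 < k -> z ^ 2 = (w ^ 2 - 1) * (k ^ 2 * w ^ 2 + 1 - k ^ 2) ->
  DE k 3 w z =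
  4 * (k * (k + 1)) * (Qp k w z * Ep k 0 w z) + (2 * k + 5) * Ep k 3 w z + 3 * Ep k 2 w z.
Proof. intros Hk Hz. unfold DE, Qp, Ep, dz. field [Hz]; lra. Qed.

Lemma mod4 j r : (r < 4)%nat -> ((4 * j + r) mod 4 = r)%nat.
Proof. intros Hr. rewrite Nat.add_comm, Nat.mul_comm, Nat.Div0.mod_add. now apply Nat.mod_small. Qed.

Lemma div4 j r : (r < 4)%nat -> ((4 * j + r) / 4 = j)%nat.
Proof. intros Hr. rewrite Nat.mul_comm, Nat.div_add_l, Nat.div_small by lia. lia. Qed.

Lemma b_cases k j :
  b k (4 * j) = (k + 3) / 2 * INR (4 * j) + 1 /\
  b k (4 * j + 1) = (3 * k + 1) / 2 * INR (4 * j + 1) + (k + 1) / 2 /\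
  b k (4 * j + 2) = (3 * k + 1) / 2 * INR (4 * j + 2) + k /\
  b k (4 * j + 3) = (k + 3) / 2 * INR (4 * j + 3) + (k + 1) / 2.
Proof.
  assert (M0 := mod4 j 0 ltac:(lia)). rewrite Nat.add_0_r in M0.
  unfold b. rewrite M0, !mod4 by lia. repeat split; field.
Qed.

Lemma Tn_cases k j r w z : (r < 4)%nat ->
  Tn k (4 * j + r) w z = cn k (4 * j + r) * (Qp k w z ^ j * Ep k r w z).
Proof.
  intros Hr. unfold Tn. now rewrite div4, mod4.
Qed.

Lemma cn_succ k j r : (r < 3)%nat ->
  cn k (4 * j + S r) = cn k (4 * j + r) * ((4 * INR j + INR (S r)) * vr k (S r)).
Proof.
  intros Hr. replace (4 * j + S r)%nat with (S (4 * j + r)) by lia. cbn [cn].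
  replace (S (4 * j + r)) with (4 * j + S r)%nat by lia.
  rewrite mod4 by lia. rewrite plus_INR, mult_INR.
  replace (INR 4) with 4 by (simpl; ring). reflexivity.
Qed.

Lemma cn_succ4 k j : cn k (4 * S j + 0) = cn k (4 * j + 3) * ((4 * INR j + 4) * vr k 0).
Proof.
  replace (4 * S j + 0)%nat with (S (4 * j + 3)) by lia. cbn [cn].
  replace (S (4 * j + 3)) with (4 * S j + 0)%nat by lia.
  rewrite mod4 by lia. rewrite plus_INR, mult_INR, (S_INR j).
  replace (INR 4) with 4 by (simpl; ring). change (INR 0) with 0. ring.
Qed.

Definition dTn (k : R) (n : nat) (w z : R) : R :=
  cn k n * (INR (n / 4) * Qp k w z ^ pred (n / 4) * DQ k w z * Ep k (n mod 4) w z
            + Qp k w z ^ (n / 4) * DE k (n mod 4) w z).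

Lemma dTn_cases k j r w z : (r < 4)%nat ->
  dTn k (4 * j + r) w z = cn k (4 * j + r) *
    (INR j * Qp k w z ^ pred j * DQ k w z * Ep k r w z + Qp k w z ^ j * DE k r w z).
Proof.
  intros Hr. unfold dTn. now rewrite div4, mod4.
Qed.

Lemma pow_pred_mult j q x W : x = 4 * q * W -> INR j * q ^ pred j * x = 4 * INR j * q ^ j * W.
Proof. intros ->. destruct j; [simpl; ring|]. simpl pred. simpl (q ^ S j). ring. Qed.

Lemma Tn_step k n w z : 0 < k -> z ^ 2 = (w ^ 2 - 1) * (k ^ 2 * w ^ 2 + 1 - k ^ 2) ->
  dTn k n w z - b k n * Tn k n w z - u k n * Tn k (pred n) w z = Tn k (S n) w z.
Proof.
  intros Hk Hz.
  pose (j := (n / 4)%nat). pose (r := (n mod 4)%nat).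
  assert (En : n = (4 * j + r)%nat) by (unfold j, r; apply Nat.div_mod_eq).
  assert (Hr : (r < 4)%nat) by (unfold r; apply Nat.mod_upper_bound; lia).
  assert (Eu : u k n = INR n ^ 2 * vr k r) by apply u_vr.
  rewrite Eu. clearbody j r. clear Eu.
  destruct (b_cases k j) as [B0 [B1 [B2 B3]]].
  assert (I4 : INR (4 * j) = 4 * INR j) by (rewrite mult_INR; simpl; ring).
  destruct r as [|[|[|[|]]]]; [| | | |lia]; subst n.
  - rewrite dTn_cases, Tn_cases by lia.
    replace (S (4 * j + 0)) with (4 * j + 1)%nat by lia. rewrite Tn_cases by lia.
    rewrite cn_succ by lia. rewrite DE_0 by exact Hk.
    (* [DQ_E0] has the term [Ep 3] without a factor [Qp], so the power [Qp^(j-1)] really occurs; it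
       belongs to [Tn] at index [4 i + 3]. For [j = 0] this term is absent, as [u 0 = 0]. *)
    destruct j as [|i].
    + simpl. unfold b; simpl. field; lra.
    + replace (pred (4 * S i + 0)) with (4 * i + 3)%nat by lia. rewrite Tn_cases by lia.
      rewrite cn_succ4. rewrite Nat.add_0_r, B0, I4. rewrite S_INR. cbn [pred vr pow].
      replace (INR 1) with 1 by reflexivity.
      replace ((INR i + 1) * Qp k w z ^ i * DQ k w z * Ep k 0 w z) with ((INR i + 1) * Qp k w z ^ i * (DQ k w z * Ep k 0 w z)) by ring.
      rewrite (DQ_E0 k w z Hk Hz). field.
  - rewrite dTn_cases, Tn_cases by lia.
    replace (S (4 * j + 1)) with (4 * j + 2)%nat by lia. rewrite Tn_cases by lia.
    replace (pred (4 * j + 1)) with (4 * j + 0)%nat by lia. rewrite Tn_cases by lia.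
    rewrite (cn_succ k j 1) by lia. rewrite (cn_succ k j 0) by lia.
    rewrite B1, plus_INR, I4, DE_1 by exact Hk.
    rewrite (Rmult_assoc _ (DQ k w z)), (pow_pred_mult _ _ _ _ (DQ_E1 k w z Hk Hz)).
    cbn [vr]. simpl (INR 1). simpl (INR 2). field.
  - rewrite dTn_cases, Tn_cases by lia.
    replace (S (4 * j + 2)) with (4 * j + 3)%nat by lia. rewrite Tn_cases by lia.
    replace (pred (4 * j + 2)) with (4 * j + 1)%nat by lia. rewrite Tn_cases by lia.
    rewrite (cn_succ k j 2) by lia. rewrite (cn_succ k j 1) by lia.
    rewrite B2, plus_INR, I4, DE_2 by exact Hk.
    rewrite (Rmult_assoc _ (DQ k w z)), (pow_pred_mult _ _ _ _ (DQ_E2 k w z Hk Hz)).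
    cbn [vr]. simpl (INR 2). simpl (INR 3). field.
  - rewrite dTn_cases, Tn_cases by lia.
    replace (S (4 * j + 3)) with (4 * S j + 0)%nat by lia. rewrite Tn_cases by lia.
    replace (pred (4 * j + 3)) with (4 * j + 2)%nat by lia. rewrite Tn_cases by lia.
    rewrite cn_succ4. rewrite (cn_succ k j 2) by lia.
    rewrite B3, plus_INR, I4, (DE_3 k w z Hk Hz).
    rewrite (Rmult_assoc _ (DQ k w z)), (pow_pred_mult _ _ _ _ (DQ_E3 k w z Hk Hz)).
    cbn [vr pow]. simpl (INR 3). field.
Qed.

Lemma is_derive_powR (f : R -> R) (x a : R) n : is_derive f x a ->
  is_derive (fun t => f t ^ n) x (INR n * f x ^ pred n * a).
Proof. intros H. eapply is_derive_eq; [exact (is_derive_pow f n x a H)|]. simpl; ring. Qed.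

Lemma Tn_derive k n (w z : R -> R) (t c : R) : 0 < k ->
  is_derive w t (c * z t) -> is_derive z t (c * dz k (w t)) ->
  is_derive (fun t => Tn k n (w t) (z t)) t (c * dTn k n (w t) (z t)).
Proof.
  intros Hk Hw Hzd.
  assert (HQ : is_derive (fun t => Qp k (w t) (z t)) t (c * DQ k (w t) (z t))).
  { unfold Qp, DQ. eapply is_derive_eq.
    - apply (is_derive_mulR _ (fun _ => / (4 * k * (1 + k) ^ 2))); [|apply is_derive_const].
      apply is_derive_minusR; [apply is_derive_minusR; [apply is_derive_plusR|apply is_derive_const]|].
      + apply (is_derive_mulR (fun _ => k ^ 2)); [apply is_derive_const|apply is_derive_powR, Hw].
      + apply (is_derive_mulR (fun _ => 2 * (1 + k))); [apply is_derive_const|apply is_derive_powR, Hw].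
      + apply (is_derive_mulR (fun t => 2 * (1 + k) * w t)); [|exact Hzd].
        apply (is_derive_mulR (fun _ => 2 * (1 + k))); [apply is_derive_const|exact Hw].
    - unfold zero; simpl. field. lra. }
  assert (HE : is_derive (fun t => Ep k (n mod 4) (w t) (z t)) t (c * DE k (n mod 4) (w t) (z t))).
  { pose proof (Nat.mod_upper_bound n 4 ltac:(lia)) as Hm.
    destruct (n mod 4)%nat as [|[|[|[|]]]]; [| | | |lia]; unfold Ep, DE.
    - exact Hw.
    - eapply is_derive_eq.
      + apply (is_derive_mulR _ (fun _ => / (2 * k))); [|apply is_derive_const].
        apply is_derive_minusR; eassumption.
      + unfold zero; simpl. field. lra.
    - eapply is_derive_eq.
      + apply (is_derive_mulR _ (fun _ => / (2 * k * (1 + k)))); [|apply is_derive_const].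
        apply is_derive_minusR; [apply is_derive_plusR|].
        * apply (is_derive_mulR (fun _ => k ^ 2)); [apply is_derive_const|apply is_derive_powR, Hw].
        * apply (is_derive_mulR (fun _ => 1 - k ^ 2)); [apply is_derive_const|exact Hw].
        * apply (is_derive_mulR (fun _ => 1 + k)); [apply is_derive_const|exact Hzd].
      + unfold zero; simpl. field. lra.
    - eapply is_derive_eq.
      + apply (is_derive_mulR _ (fun _ => / (4 * k * (1 + k)))); [|apply is_derive_const].
        apply is_derive_plusR; [apply is_derive_minusR; [apply is_derive_plusR|]|].
        * apply (is_derive_mulR (fun t => k * w t ^ 2)); [|exact Hzd].
          apply (is_derive_mulR (fun _ => k)); [apply is_derive_const|apply is_derive_powR, Hw].
        * apply (is_derive_mulR (fun _ => k + 1)); [apply is_derive_const|exact Hzd].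
        * apply (is_derive_mulR (fun _ => k * (1 + 2 * k))); [apply is_derive_const|apply is_derive_powR, Hw].
        * apply (is_derive_mulR (fun _ => (1 + k) * (2 * k - 1))); [apply is_derive_const|exact Hw].
      + unfold zero; simpl. field. lra. }
  eapply is_derive_eq.
  - unfold Tn. apply (is_derive_mulR (fun _ => cn k n)); [apply is_derive_const|].
    apply is_derive_mulR; [apply is_derive_powR, HQ|exact HE].
  - unfold zero, dTn; simpl. ring.
Qed.

(** On [w = z] with this value of [w^2], both [Qp] and [Ep 1], [Ep 2], [Ep 3] vanish. For [n >= 4] a
    power of [Qp] is present, and for [n = 1, 2, 3] one of the others. *)
Lemma Tn_at_zero k n w : 0 < k -> w ^ 2 = (1 + k) / k -> Tn k n w w = if Nat.eqb n 0 then w else 0.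
Proof.
  intros Hk Hw.
  assert (EQ : Qp k w w = 0).
  { unfold Qp. replace (w ^ 4) with (w ^ 2 * w ^ 2) by ring.
    replace (2 * (1 + k) * w * w) with (2 * (1 + k) * w ^ 2) by ring. rewrite Hw. field. lra. }
  unfold Tn. destruct (Nat.eqb_spec n 0) as [->|Hn]; [simpl; ring|].
  destruct (n / 4)%nat eqn:D; [|rewrite EQ; simpl; ring].
  assert (Hn4 : (n < 4)%nat) by (apply Nat.div_small_iff in D; lia).
  rewrite Nat.mod_small by exact Hn4.
  replace (Ep k n w w) with 0; [ring|].
  destruct n as [|[|[|[|]]]]; [lia| | | |lia]; unfold Ep.
  - field. lra.
  - replace (w ^ 3) with (w ^ 2 * w) by ring. rewrite Hw. field. lra.
  - replace (w ^ 3) with (w ^ 2 * w) by ring. rewrite Hw. field. lra.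
Qed.

(** * Moments of the exponentially tilted weights *)

Definition node y s := 2 * half s / G0 y.
(** The factor [/ F0 y] makes the moment of [1] equal to nc; at [t = y / 2] the weights are the
    [M_s]. *)
Definition moment y (p : R -> R) := esum half (fun s => / F0 y * (p (node y s) * fc y s)).
Definition padm y (p : R -> R) := admissible y half (fun s => / F0 y * (p (node y s) * fc y s)).

Lemma padm_mulx y p : 0 < y -> padm y p -> padm y (fun x => x * p x).
Proof.
  intros Hy H. apply (admissible_ext _ _ (fun s => 2 / G0 y * (half s * (/ F0 y * (p (node y s) * fc y s))))).
  - intros s. unfold node. pose proof (G0_pos y Hy). pose proof (F0_pos y Hy). field. lra.
  - apply admissible_scal, admissible_mul, H.
Qed.

Lemma padm_lin y p q c d : padm y p -> padm y q -> padm y (fun x => c * p x + d * q x).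
Proof.
  intros H1 H2. eapply admissible_ext; [|exact (admissible_plus _ _ _ _
    (admissible_scal _ _ _ c H1) (admissible_scal _ _ _ d H2))].
  intros s; simpl; ring.
Qed.

Lemma padm_ext y p q : (forall x, p x = q x) -> padm y p -> padm y q.
Proof. intros E. apply admissible_ext. intros s; now rewrite E. Qed.

Lemma moment_lin y p q c d t : padm y p -> padm y q -> Rabs t < y ->
  moment y (fun x => c * p x + d * q x) t = c * moment y p t + d * moment y q t.
Proof.
  intros H1 H2 Ht. unfold moment, esum. rewrite <- !zsum_scal, <- zsum_plus.
  - apply zsum_ext; intros s; ring.
  - apply zabs_scal, H1, Ht.
  - apply zabs_scal, H2, Ht.
Qed.

Lemma moment_ext y p q t : (forall x, p x = q x) -> moment y p t = moment y q t.
Proof. intros E. apply esum_ext. intros s; now rewrite E. Qed.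

Lemma moment_derive y p t : 0 < y -> padm y p -> Rabs t < y ->
  is_derive (moment y p) t (G0 y / 2 * moment y (fun x => x * p x) t).
Proof.
  intros Hy H Ht. eapply is_derive_eq; [exact (esum_derive y _ _ t H Ht)|].
  unfold moment, esum. rewrite <- zsum_scal. apply zsum_ext; intros s. unfold node.
  pose proof (G0_pos y Hy). pose proof (F0_pos y Hy). field. lra.
Qed.

Lemma padm_P_mul y kp p n : 0 < y -> padm y p -> padm y (fun x => P kp n x * p x).
Proof.
  intros Hy Hp.
  (* Two consecutive indices go through the induction, as the recurrence reaches two steps back. *)
  enough (K : padm y (fun x => P kp n x * p x) /\ padm y (fun x => P kp (S n) x * p x)) by apply K.
  induction n as [|n [I1 I2]].
  - assert (K0 : padm y (fun x => P kp 0 x * p x)).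
    { eapply padm_ext; [|exact Hp]. intros x; unfold P; simpl; ring. }
    split; [exact K0|].
    eapply padm_ext; [|exact (padm_lin y _ _ 1 (- b kp 0) (padm_mulx y _ Hy K0) K0)].
    intros x; simpl. unfold P; simpl; ring.
  - split; [exact I2|].
    eapply padm_ext; [|exact (padm_lin y _ _ 1 (- u kp (S n))
      (padm_lin y _ _ 1 (- b kp (S n)) (padm_mulx y _ Hy I2) I2) I1)].
    intros x; simpl. rewrite (P_succ kp (S n)). simpl pred. ring.
Qed.

Lemma padm_one y : 0 < y -> padm y (fun _ => 1).
Proof. intros Hy. unfold padm. apply admissible_scal, admissible_scal, admissible_fc, Hy. Qed.

Lemma padm_P y kp n : 0 < y -> padm y (P kp n).
Proof.
  intros Hy. eapply padm_ext; [|exact (padm_P_mul y kp _ n Hy (padm_one y Hy))]. intros; simpl; ring.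
Qed.

Lemma moment_mulx_P y kp p n t : 0 < y -> padm y p -> Rabs t < y ->
  moment y (fun x => x * (P kp n x * p x)) t =
  moment y (fun x => P kp (S n) x * p x) t + b kp n * moment y (fun x => P kp n x * p x) t
  + u kp n * moment y (fun x => P kp (pred n) x * p x) t.
Proof.
  intros Hy Hp Ht.
  pose proof (fun n => padm_P_mul y kp p n Hy Hp) as K.
  rewrite (moment_ext y _ (fun x => 1 * (1 * (P kp (S n) x * p x) + b kp n * (P kp n x * p x)) + u kp n * (P kp (pred n) x * p x))).
  - rewrite (moment_lin y (fun x => 1 * (P kp (S n) x * p x) + b kp n * (P kp n x * p x)) (fun x => P kp (pred n) x * p x))
      by auto using padm_lin.
    rewrite (moment_lin y (fun x => P kp (S n) x * p x) (fun x => P kp n x * p x)) by auto. ring.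
  - intros x. rewrite P_succ. ring.
Qed.

Definition nc y t := Fr y t / F0 y.
Definition nc' y t := (Hr y t / F0 y) * (Gr y t / G0 y).

Lemma nc'_sq y t : 0 < y -> Rabs t < y ->
  nc' y t ^ 2 = (nc y t ^ 2 - 1) * (kpy y ^ 2 * nc y t ^ 2 + 1 - kpy y ^ 2).
Proof.
  intros Hy Ht. pose proof (G0_pos y Hy). pose proof (F0_pos y Hy).
  pose proof (Fr_Hr y t Hy Ht) as EF. pose proof (Gr_Hr y t Hy Ht) as EG.
  unfold nc, nc', kpy, Rdiv. rewrite !Rpow_mult_distr, EG, EF. field. lra.
Qed.

Lemma nc_derive y t : 0 < y -> Rabs t < y -> is_derive (nc y) t (G0 y / 2 * nc' y t).
Proof.
  intros Hy Ht. pose proof (G0_pos y Hy). pose proof (F0_pos y Hy). eapply is_derive_eq.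
  - apply (is_derive_mulR (Fr y) (fun _ => / F0 y)); [now apply Fr_derive|apply is_derive_const].
  - unfold zero, nc'; simpl. field. lra.
Qed.

Lemma nc'_derive y t : 0 < y -> Rabs t < y -> is_derive (nc' y) t (G0 y / 2 * dz (kpy y) (nc y t)).
Proof.
  intros Hy Ht. pose proof (G0_pos y Hy). pose proof (F0_pos y Hy).
  pose proof (Fr_Hr y t Hy Ht) as EF. pose proof (Gr_Hr y t Hy Ht) as EG.
  eapply is_derive_eq.
  - apply (is_derive_mulR (fun t => Hr y t / F0 y) (fun t => Gr y t / G0 y)).
    + apply (is_derive_mulR (Hr y) (fun _ => / F0 y)); [now apply Hr_derive|apply is_derive_const].
    + apply (is_derive_mulR (Gr y) (fun _ => / G0 y)); [now apply Gr_derive|apply is_derive_const].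
  - unfold zero; cbn -[pow]. unfold dz, nc, kpy.
    replace (_ + _) with (Fr y t * (Gr y t ^ 2 + Hr y t ^ 2) / (2 * F0 y * G0 y)) by (field; lra).
    rewrite EG. replace (Hr y t ^ 2) with (Fr y t ^ 2 - F0 y ^ 2) by lra. field. lra.
Qed.

(** Both sides obey the same recurrence: the moments because differentiation multiplies by the node,
    the closed form by [Tn_step]. *)
Lemma moment_P y n t : 0 < y -> Rabs t < y ->
  moment y (P (kpy y) n) t = Tn (kpy y) n (nc y t) (nc' y t).
Proof.
  intros Hy Ht. pose proof (kpy_bounds y Hy) as Hk. set (k := kpy y) in *.
  pose proof (G0_pos y Hy) as HG.
  assert (S1 : forall n, (forall t, Rabs t < y -> moment y (P k n) t = Tn k n (nc y t) (nc' y t)) ->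
    (forall t, Rabs t < y -> u k n * moment y (P k (pred n)) t = u k n * Tn k (pred n) (nc y t) (nc' y t)) ->
    forall t, Rabs t < y -> moment y (P k (S n)) t = Tn k (S n) (nc y t) (nc' y t)).
  { clear n t Ht. intros n H1 H2 t Ht.
    rewrite <- (Tn_step k n) by (try apply nc'_sq; tauto || lra).
    pose proof (moment_mulx_P y k (fun _ => 1) n t Hy (padm_one y Hy) Ht) as E.
    rewrite (moment_ext y (fun x => P k (S n) x * 1) (P k (S n))) in E by (intros; ring).
    rewrite (moment_ext y (fun x => P k n x * 1) (P k n)) in E by (intros; ring).
    rewrite (moment_ext y (fun x => P k (pred n) x * 1) (P k (pred n))) in E by (intros; ring).
    rewrite (moment_ext y (fun x => x * (P k n x * 1)) (fun x => x * P k n x)) in E by (intros; ring).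
    rewrite H2, H1 in E by exact Ht.
    (* The equality at [n] holds in a neighbourhood of [t], so its two sides may be differentiated
       and [G0 y / 2] cancelled. *)
    assert (D : moment y (fun x => x * P k n x) t = dTn k n (nc y t) (nc' y t)); [|lra].
    apply Rmult_eq_reg_l with (G0 y / 2); [|lra].
    rewrite <- (is_derive_unique _ _ _ (moment_derive y _ t Hy (padm_P y k n Hy) Ht)).
    apply is_derive_unique.
    apply (is_derive_ext_loc (fun t => Tn k n (nc y t) (nc' y t))).
    - assert (Hd : 0 < y - Rabs t) by lra. exists (mkposreal _ Hd). intros s Hs. symmetry. apply H1.
      change (Rabs (s - t) < y - Rabs t) in Hs.
      replace s with (s - t + t) by ring. eapply Rle_lt_trans; [apply Rabs_triang|]. lra.
    - apply Tn_derive; [lra|now apply nc_derive|now apply nc'_derive]. }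
  enough (K : (forall t, Rabs t < y -> moment y (P k n) t = Tn k n (nc y t) (nc' y t)) /\
    (forall t, Rabs t < y -> u k n * moment y (P k (pred n)) t = u k n * Tn k (pred n) (nc y t) (nc' y t)))
    by now apply K.
  clear t Ht. induction n as [|n [I1 I2]].
  - split; intros t Ht.
    + transitivity (nc y t); [|unfold Tn; simpl; ring].
      unfold moment, nc, Fr, esum, Rdiv. rewrite (Rmult_comm (zsum _)), <- zsum_scal.
      apply zsum_ext; intros s. unfold P; simpl. ring.
    + rewrite u_vr. simpl. ring.
  - split; [now apply S1|]. intros t Ht. simpl pred. now rewrite I1.
Qed.

(** With [Hr^2 = F0 G0] at [y / 2], the first integrals give [nc^2 = 1 + G0 / F0] and
    [nc'^2 = (G0 / F0) (1 + F0 / G0)], the same number; positivity removes the sign. *)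
Lemma nc_half y : 0 < y -> nc y (y / 2) ^ 2 = (1 + kpy y) / kpy y /\ 0 < nc y (y / 2)
  /\ nc' y (y / 2) = nc y (y / 2).
Proof.
  intros Hy. assert (Ht : Rabs (y / 2) < y) by (rewrite Rabs_pos_eq; lra).
  pose proof (G0_pos y Hy). pose proof (F0_pos y Hy).
  pose proof (Fr_Hr y _ Hy Ht) as EF. pose proof (Gr_Hr y _ Hy Ht) as EG.
  destruct (Hr_half y Hy) as [EH PH]. set (t := y / 2) in *. pose proof (Fr_pos y _ Hy Ht) as PF. pose proof (Gr_pos y _ Hy Ht) as PG.
  assert (E1 : nc y t ^ 2 = (1 + kpy y) / kpy y).
  { unfold nc, kpy, Rdiv. rewrite Rpow_mult_distr, EF, EH. field. lra. }
  assert (P1 : 0 < nc y t) by now apply Rdiv_lt_0_compat.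
  assert (P2 : 0 < nc' y t) by (apply Rmult_lt_0_compat; now apply Rdiv_lt_0_compat).
  repeat split; [exact E1|exact P1|].
  assert (E2 : nc' y t ^ 2 = nc y t ^ 2).
  { rewrite E1. unfold nc', kpy, Rdiv. rewrite !Rpow_mult_distr, EG, EH. field. lra. }
  apply Rsqr_inj; unfold Rsqr; lra.
Qed.

(** Expanding [x P_n P_m] through either factor gives the symmetry needed by [favard]; column 0 is
    the closed form at the point where [nc' = nc], so its only non-zero entry is [nc = c0]. *)
Lemma moment_orthogonal y n m : 0 < y ->
  moment y (fun x => P (kpy y) n x * P (kpy y) m x) (y / 2) = if Nat.eqb n m then h (kpy y) n else 0.
Proof.
  intros Hy. assert (Ht : Rabs (y / 2) < y) by (rewrite Rabs_pos_eq; lra).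
  pose proof (kpy_bounds y Hy) as Hk. set (k := kpy y) in *.
  apply (favard (fun n m => moment y (fun x => P k n x * P k m x) (y / 2)) (b k) (u k)).
  - intros i j. apply moment_ext; intros; ring.
  - rewrite u_vr; simpl; ring.
  - intros i j.
    rewrite <- (moment_mulx_P y k (P k j) i _ Hy (padm_P y k j Hy) Ht).
    rewrite (moment_ext y (fun x => x * (P k i x * P k j x)) (fun x => x * (P k j x * P k i x))) by (intros; ring).
    rewrite (moment_mulx_P y k (P k i) j _ Hy (padm_P y k i Hy) Ht).
    f_equal; [f_equal|]; [|f_equal|f_equal]; apply moment_ext; intros; ring.
  - intros i. rewrite (moment_ext y _ (P k i)) by (intros; unfold P at 2; simpl; ring).
    unfold k. rewrite moment_P by assumption. fold k.
    destruct (nc_half y Hy) as [E1 [P1 ->]]. rewrite Tn_at_zero by (exact E1 || lra).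
    destruct (Nat.eqb i 0); [|reflexivity].
    unfold h, c0. fold k in E1. rewrite <- E1. symmetry; apply sqrt_pow2; lra.
  - intros j. reflexivity.
Qed.

Theorem theorem2 (kp : R) (hkp0 : 0 < kp) (hkp1 : kp < 1) (n m : nat) :
  is_series
    (fun j : nat => term kp n m (Z.of_nat j) + term kp n m (- Z.of_nat j - 1)%Z)
    (if Nat.eqb n m then h kp n else 0).
Proof.
  destruct (identify kp (conj hkp0 hkp1)) as [Hy [Ek EK]].
  set (y := PI * ellK (sqrt (1 - kp ^ 2)) / ellK kp) in *.
  assert (Ht : Rabs (y / 2) < y) by (rewrite Rabs_pos_eq; lra).
  pose proof (G0_pos y Hy) as HG. pose proof (F0_pos y Hy) as HF. pose proof PI_RGT_0 as HPI.
  pose proof (moment_orthogonal y n m Hy) as O. rewrite Ek in O.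
  change (is_zsum (term kp n m) (if Nat.eqb n m then h kp n else 0)). rewrite <- O.
  pose proof (padm_P_mul y kp _ n Hy (padm_P y kp m Hy) _ Ht) as A.
  apply zabs_correct in A. refine (is_zsum_ext _ _ _ _ A).
  intros s. unfold term.
  assert (Ex : xs kp s = node y s).
  { unfold xs, node, half. rewrite EK. field. lra. }
  (* [PI / (kp * ellK kp)] equals [2 / F0 y], because [ellK kp = PI * G0 y / 2] and
     [kp = F0 y / G0 y]; the 2 is absorbed by the hyperbolic cosine. *)
  assert (EM : Ms kp s = / F0 y * (fc y s * exp (half s * (y / 2)))).
  { unfold Ms. fold (half s). unfold Rpower, vv.
    replace (- PI * ellK (sqrt (1 - kp ^ 2)) / ellK kp) with (- y) by (unfold y, Rdiv; ring).
    rewrite ln_exp.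
    replace (- half s / 2 * - y) with (half s * (y / 2)) by field.
    replace (half s * - y) with (- (half s * y)) by ring.
    replace (- half s * - y) with (half s * y) by ring.
    rewrite EK. rewrite <- Ek at 1. unfold kpy, fc, cosh.
    pose proof (exp_pos (half s * y)). pose proof (exp_pos (- (half s * y))).
    field. repeat split; lra. }
  rewrite Ex, EM. ring.
Qed.
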